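(* Let $N\ge2$ and $d_1,\dots,d_N\ge2$, and set $D=d_1\cdots d_N$, $B=\sum_{i_1,\dots,i_N\in\{0,1\}}d_1^{i_1}\cdots d_N^{i_N}$, and $C=\sum_{A|B'}(d_A+d_{B'})$. Then the Haar averages of the entangling power satisfy $$\langle\varepsilon_\tau\rangle_{O(D)}=2\left[1-\Big(\prod_{i=1}^N\frac{1}{d_i+1}\Big)\frac{2^N(D+1)-2B+\frac{BD-2^N}{2^{N-1}-1}C}{(D-1)(D+2)}\right]$$ and $$\langle\varepsilon_\tau\rangle_{U(D)}=2\left[1-\Big(\prod_{i=1}^N\frac{1}{d_i+1}\Big)\frac{BC}{(2^{N-1}-1)(D+1)}\right].$$
   Context: Consider $\mathcal{H}=\mathbb{C}^{d_1}\otimes\cdots\otimes\mathbb{C}^{d_N}$. The sum $\sum_{A|B'}$ runs over all $2^{N-1}-1$ unordered bipartitions of $\{1,\dots,N\}$ into disjoint nonempty sets $A,B'$, and $d_A=\prod_{i\in A}d_i$. For a pure state $|\psi\rangle$, $\tau_{A|B'}(|\psi\rangle)=2\big(1-\mathrm{Tr}(\mathrm{Tr}_{B'}|\psi\rangle\langle\psi|)^2\big)$, and the one-tangle is $\tau_1=\frac{1}{2^{N-1}-1}\sum_{A|B'}\tau_{A|B'}$. The entangling power of a unitary $U$ on $\mathcal{H}$ is $\varepsilon_\tau(U)=\langle\tau_1(U|\psi_1\rangle\cdots|\psi_N\rangle)\rangle$, averaged over product states with each $|\psi_i\rangle$ drawn independently from the uniform measure on the unit sphere of $\mathbb{C}^{d_i}$.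 $\langle\cdot\rangle_{O(D)}$ and $\langle\cdot\rangle_{U(D)}$ denote averages over the Haar measure on the orthogonal and unitary group of size $D$. *)

(* Defs.v *)
From HB Require Import structures.
From mathcomp Require Import all_boot all_order all_algebra.
From mathcomp Require Import all_classical all_reals all_analysis.
From mathcomp Require Export complex.
Set Implicit Arguments. Unset Strict Implicit. Unset Printing Implicit Defensive.
Import Order.TTheory GRing.Theory Num.Theory.
Local Open Scope classical_set_scope.
Local Open Scope ring_scope.

Section Defs.
Variable R : realType.
Local Notation C := R[i].

Definition cmx_of_tuple n (t : (n * n + n * n).-tuple R) : 'M[C]_n :=
  \matrix_(i, j) Complex (tnth t (lshift _ (mxvec_index i j)))
                         (tnth t (rshift _ (mxvec_index i j))).

Definition tuple_of_cmx n (M : 'M[C]_n) : (n * n + n * n).-tuple R :=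
  [tuple match fintype.split k with
         | inl a => complex.Re (mxvec M 0 a)
         | inr b => complex.Im (mxvec M 0 b) end | k < n * n + n * n].

Definition rmx_of_tuple n (t : (n * n).-tuple R) : 'M[R]_n :=
  \matrix_(i, j) tnth t (mxvec_index i j).

Definition tuple_of_rmx n (M : 'M[R]_n) : (n * n).-tuple R :=
  [tuple mxvec M 0 k | k < n * n].

Definition cvec_of_tuple d (t : (d + d).-tuple R) : seq C :=
  [seq Complex (tnth t (lshift d k)) (tnth t (rshift d k)) | k <- enum 'I_d].

Definition unitary_mx n (V : 'M[C]_n) : Prop := V *m (map_mx (@conjc R) V)^T = 1%:M.
Definition orthogonal_mx n (O : 'M[R]_n) : Prop := O *m O^T = 1%:M.

Definition Haar_unitary n (mu : probability ((n * n + n * n).-tuple R) R) : Prop :=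
  mu [set t | unitary_mx (cmx_of_tuple t)] = 1%E /\
  forall V : 'M[C]_n, unitary_mx V -> forall E, measurable E ->
    mu ((fun t => tuple_of_cmx (V *m cmx_of_tuple t)) @^-1` E) = mu E.

Definition Haar_orthogonal n (mu : probability ((n * n).-tuple R) R) : Prop :=
  mu [set t | orthogonal_mx (rmx_of_tuple t)] = 1%E /\
  forall V : 'M[R]_n, orthogonal_mx V -> forall E, measurable E ->
    mu ((fun t => tuple_of_rmx (V *m rmx_of_tuple t)) @^-1` E) = mu E.

Definition uniform_sphere d (nu : probability ((d + d).-tuple R) R) : Prop :=
  nu [set t | \sum_(k < d + d) tnth t k ^+ 2 = 1] = 1%E /\
  forall O : 'M[R]_(d + d), orthogonal_mx O -> forall E, measurable E ->
    nu ((fun t => [tuple \sum_l O k l * tnth t l | k < d + d]) @^-1` E) = nu E.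

Fixpoint mindices (ds : seq nat) : seq (seq nat) :=
  if ds is d :: ds' then [seq j :: js | j <- iota 0 d, js <- mindices ds'] else [:: [::]].

(* lexicographic (standard Kronecker) position of a multi-index in C^(d_1 ... d_m) *)
Fixpoint lin_index (ds js : seq nat) : nat :=
  match ds, js with
  | d :: ds', j :: js' => (j * \prod_(e <- ds') e + lin_index ds' js')%N
  | _, _ => 0%N
  end.

Definition dims (N : nat) (d : nat -> nat) : seq nat := [seq d i | i <- iota 0 N].

Definition Dim (N : nat) (d : nat -> nat) : nat := (\prod_(i < N) d i)%N.

Definition ent n (M : 'M[C]_n) (a b : nat) : C :=
  match (insub a : option 'I_n), (insub b : option 'I_n) with
  | Some i, Some j => M i j
  | _, _ => 0
  end.

Definition prod_amp (N : nat) (psis : seq (seq C)) (j : seq nat) : C :=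
  \prod_(i < N) nth 0 (nth [::] psis i) (nth 0%N j i).

Definition evolve N d n (U : 'M[C]_n) (psis : seq (seq C)) (j : seq nat) : C :=
  \sum_(k <- mindices (dims N d))
     ent U (lin_index (dims N d) j) (lin_index (dims N d) k) * prod_amp N psis k.

Definition join (N : nat) (A : seq nat) (a b : seq nat) : seq nat :=
  let B := [seq i <- iota 0 N | i \notin A] in
  [seq (if i \in A then nth 0%N a (index i A) else nth 0%N b (index i B)) | i <- iota 0 N].

(* Tr (Tr_{B'} |phi><phi|)^2, for the subsystem A (list of sites, increasing) *)
Definition purity N (d : nat -> nat) (A : seq nat) (phi : seq nat -> C) : C :=
  let B := [seq i <- iota 0 N | i \notin A] in
  let rho a a' := \sum_(b <- mindices (map d B)) phi (join N A a b) * conjc (phi (join N A a' b)) in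
  \sum_(a <- mindices (map d A)) \sum_(a' <- mindices (map d A)) rho a a' * rho a' a.

Definition tau_bip N d (A : seq nat) (phi : seq nat -> C) : R :=
  2 * (1 - complex.Re (purity N d A phi)).

(* unordered bipartitions A|B' are represented by the part A containing site 0 *)
Definition bip_rep N (A : {set 'I_N}) : bool :=
  [exists i in A, val i == 0%N] && (A != [set: 'I_N]%SET).

Definition sites N (A : {set 'I_N}) : seq nat := [seq val i | i <- enum A].

Definition one_tangle N d (phi : seq nat -> C) : R :=
  ((2 : R) ^+ N.-1 - 1)^-1 * \sum_(A : {set 'I_N} | bip_rep A) tau_bip N d (sites A) phi.

Fixpoint nested_int (d : nat -> nat) (nu : forall i : nat, probability ((d i + d i).-tuple R) R)
    (F : seq (seq C) -> \bar R) (js : seq nat) (acc : seq (seq C)) : \bar R :=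
  match js with
  | [::] => F acc
  | i :: js' => (\int[nu i]_x nested_int nu F js' (rcons acc (cvec_of_tuple x)))%E
  end.

Definition ent_power N d (nu : forall i : nat, probability ((d i + d i).-tuple R) R)
    n (U : 'M[C]_n) : \bar R :=
  nested_int nu (fun psis => (one_tangle N d (evolve N d U psis))%:E) (iota 0 N) [::].

Definition constB N d : nat := (\sum_(s : {set 'I_N}) \prod_(i in s) d (val i))%N.
Definition constC N d : nat :=
  (\sum_(A : {set 'I_N} | bip_rep A) (\prod_(i in A) d (val i) + \prod_(i in ~: A) d (val i)))%N.

End Defs.

(* Main.v *)
(* Averaging over the input states and then over the group replaces the quartic tensor
   phi phi conj(phi) conj(phi) of phi = U (psi_1 x ... x psi_N) by a D^4 tensor X invariant under
   left multiplication. Invariance under real reflections forces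
     X i1 i2 i3 i4 = a [i1=i3][i2=i4] + b [i1=i4][i2=i3] + c [i1=i2][i3=i4],
   and invariance under one diagonal phase forces c = 0 in the unitary case. The coefficients need no
   Weingarten calculus: the contractions of X are those of the input tensor, since U is isometric, and
   factor over the sites, giving a = b, a (D^2 + D) + c D = 1 and, for O(D),
   2 a D + c D^2 = 2^N prod_i 1/(d_i+1). The same argument on C^d (n x 1 matrices) gives the sphere
   moments. The average purity over A|B' is then a D (d_A + d_B') + c D, and the constant B of the
   theorem cancels the prefactor: B = prod_i (d_i + 1). *)

Require Import Defs.
From HB Require Import structures.
From mathcomp Require Import all_boot all_order all_algebra perm.
From mathcomp Require Import all_classical all_reals all_analysis.
From mathcomp Require Import measurable_realfun complex.
From mathcomp Require Import ring.
Import Order.TTheory GRing.Theory Num.Theory.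
Local Open Scope classical_set_scope.
Local Open Scope ring_scope.

Set Implicit Arguments.
Unset Strict Implicit.
Unset Printing Implicit Defensive.

(** The given measures live on whole spaces of real tuples, where coordinates are unbounded, and
    merely give full mass to the sphere or the group. All integrability therefore comes from
    [cgood]: global measurability plus a bound on a measurable set [W] of full measure. The
    one-tangle is quartic in the state but affine in the real parts of the entries of the quartic
    tensor, and it reads only finitely many of them. Every integral, over an input state or over the
    group, thus passes through one fixed functional, [tangle_form], and acts on tensor entries. This
    lets the inputs be averaged one site at a time, in the order of the nested integrals, without a
    product measure or Fubini. Real orthogonal matrices are embedded into complex ones, so that both
    groups share the moment calculus. They differ only in the last equation: for real entries a
    third contraction is available, for U(D) the phase invariance replaces it. *)

Lemma ReD (R : realType) (a b : R[i]) : complex.Re (a + b) = complex.Re a + complex.Re b.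
Proof. by case: a b => [a1 a2] [b1 b2]. Qed.

Lemma ImD (R : realType) (a b : R[i]) : complex.Im (a + b) = complex.Im a + complex.Im b.
Proof. by case: a b => [a1 a2] [b1 b2]. Qed.

Lemma ReM (R : realType) (a b : R[i]) :
  complex.Re (a * b) = complex.Re a * complex.Re b - complex.Im a * complex.Im b.
Proof. by case: a b => [a1 a2] [b1 b2]. Qed.

Lemma ImM (R : realType) (a b : R[i]) :
  complex.Im (a * b) = complex.Re a * complex.Im b + complex.Im a * complex.Re b.
Proof. by case: a b => [a1 a2] [b1 b2]. Qed.

Lemma Re_conj (R : realType) (a : R[i]) : complex.Re (conjc a) = complex.Re a.
Proof. by case: a. Qed.

Lemma Im_conj (R : realType) (a : R[i]) : complex.Im (conjc a) = - complex.Im a.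
Proof. by case: a. Qed.

Lemma complex_eqP (R : realType) (a b : R[i]) :
  complex.Re a = complex.Re b -> complex.Im a = complex.Im b -> a = b.
Proof. by case: a b => [a1 a2] [b1 b2] /= -> ->. Qed.

Lemma Re_sum (R : realType) I (s : seq I) (F : I -> R[i]) :
  complex.Re (\sum_(q <- s) F q) = \sum_(q <- s) complex.Re (F q).
Proof. by elim: s => [|q s IH]; rewrite ?big_nil // !big_cons ReD IH. Qed.

Lemma Re_natM (R : realType) (n : nat) (a : R[i]) :
  complex.Re (n%:R * a) = n%:R * complex.Re a.
Proof. by rewrite -(rmorph_nat (real_complex R)) ReM /= mul0r subr0. Qed.

(** * Complex expectations of functions bounded on a set of full measure *)

Section Expectation.
Context (R : realType) (dd : measure_display) (T : measurableType dd).
Variables (P : probability T R) (W : set T).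

(** Polynomials in the coordinates are unbounded on the ambient space, so the bound is asked only on
    [W], the sphere or the group. Measurability stays global because the integrals run over the
    whole space. *)
Definition rgood (f : T -> R) :=
  measurable_fun setT f /\ exists M, forall x, W x -> `|f x| <= M.

Definition cgood (f : T -> R[i]) :=
  rgood (fun x => complex.Re (f x)) /\ rgood (fun x => complex.Im (f x)).

(** [fine] makes the expectation total; a non-finite integral would be read as 0, a case that
    [cgood] excludes once [W] has full measure. *)
Definition CE (f : T -> R[i]) : R[i] :=
  Complex (fine (\int[P]_x (complex.Re (f x))%:E)) (fine (\int[P]_x (complex.Im (f x))%:E)).

Lemma rgood_cst c : rgood (fun=> c).
Proof. by split; [exact: measurable_cst|exists `|c|]. Qed.

Lemma rgoodD f g : rgood f -> rgood g -> rgood (fun x => f x + g x).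
Proof.
move=> [mf [M Mf]] [mg [K Kg]]; split; first exact: measurable_funD.
exists (M + K) => x Wx; apply: le_trans (ler_normD _ _) _.
by rewrite lerD ?Mf ?Kg.
Qed.

Lemma rgoodM f g : rgood f -> rgood g -> rgood (fun x => f x * g x).
Proof.
move=> [mf [M Mf]] [mg [K Kg]]; split; first exact: measurable_funM.
exists (M * K) => x Wx; rewrite normrM.
by apply: ler_pM; rewrite ?Mf ?Kg.
Qed.

Lemma rgoodN f : rgood f -> rgood (fun x => - f x).
Proof.
move=> gf; have -> : (fun x => - f x) = (fun x => (-1) * f x).
  by apply/funext => x; rewrite mulN1r.
by apply: rgoodM => //; exact: rgood_cst.
Qed.

Lemma cgood_cst c : cgood (fun=> c).
Proof. by split; exact: rgood_cst. Qed.

Lemma cgoodD f g : cgood f -> cgood g -> cgood (fun x => f x + g x).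
Proof.
move=> [f1 f2] [g1 g2]; split.
  by under eq_fun do rewrite ReD; exact: rgoodD.
by under eq_fun do rewrite ImD; exact: rgoodD.
Qed.

Lemma cgoodM f g : cgood f -> cgood g -> cgood (fun x => f x * g x).
Proof.
move=> [f1 f2] [g1 g2]; split.
  by under eq_fun do rewrite ReM; apply: rgoodD; [|apply: rgoodN]; exact: rgoodM.
by under eq_fun do rewrite ImM; apply: rgoodD; exact: rgoodM.
Qed.

Lemma cgoodJ f : cgood f -> cgood (fun x => conjc (f x)).
Proof.
move=> [f1 f2]; split; first by under eq_fun do rewrite Re_conj.
by under eq_fun do rewrite Im_conj; exact: rgoodN.
Qed.

Lemma cgood_sum I (s : seq I) (F : I -> T -> R[i]) :
  (forall q, cgood (F q)) -> cgood (fun x => \sum_(q <- s) F q x).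
Proof.
move=> gF; elim: s => [|q s IH].
  by under eq_fun do rewrite big_nil; exact: cgood_cst.
by under eq_fun do rewrite big_cons; exact: cgoodD.
Qed.

Hypotheses (mW : measurable W) (PW : P W = 1%E).

Lemma full_setC0 : P (~` W) = 0%E.
Proof. by rewrite (probability_setC P mW) PW subee. Qed.

(** The complement of [W] is null, so integrability may be tested on [W], where a bounded measurable
    function is integrable against a finite measure. *)
Lemma rgood_integrable f : rgood f -> P.-integrable setT (EFin \o f).
Proof.
move=> [mf [M Mf]].
have h := @negligible_integrable _ _ _ P setT (~` W) (EFin \o f) (measurableC mW)
  measurableT ((measurable_EFinP _ _).2 mf) full_setC0.
apply/h; rewrite setTD setCK.
apply: measurable_bounded_integrable => //.
- by move: PW => /= ->; rewrite ltry.
- exact: measurable_funTS.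
- exists M; split; first exact: num_real.
  by move=> y My x Wx; apply: (le_trans (Mf x Wx)); exact: ltW.
Qed.

Lemma rgood_int_fin f : rgood f -> (\int[P]_x (f x)%:E)%E \is a fin_num.
Proof. by move=> gf; apply: integrable_fin_num => //; exact: rgood_integrable. Qed.

Lemma rgood_integralD f g : rgood f -> rgood g ->
  fine (\int[P]_x (f x + g x)%:E) = fine (\int[P]_x (f x)%:E) + fine (\int[P]_x (g x)%:E).
Proof.
move=> gf gg; rewrite -fineD ?rgood_int_fin //; congr fine.
under eq_integral do rewrite EFinD.
by rewrite integralD //; exact: rgood_integrable.
Qed.

Lemma rgood_integralZ c f : rgood f ->
  fine (\int[P]_x (c * f x)%:E) = c * fine (\int[P]_x (f x)%:E).
Proof.
move=> gf.
rewrite -[c in RHS]/(fine c%:E) -fineM ?rgood_int_fin //; congr fine.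
under eq_integral do rewrite EFinM.
by rewrite integralZl //; exact: rgood_integrable.
Qed.

Lemma integral_prob_cst (c : R) : (\int[P]_x c%:E = c%:E)%E.
Proof. by rewrite integral_cst //; have /= -> := probability_setT P; rewrite mule1. Qed.

Lemma CE_cst c : CE (fun=> c) = c.
Proof.
by rewrite /CE !integral_prob_cst; case: c.
Qed.

Lemma CED f g : cgood f -> cgood g -> CE (fun x => f x + g x) = CE f + CE g.
Proof.
move=> [f1 f2] [g1 g2]; apply: complex_eqP.
  rewrite ReD /= -rgood_integralD //.
  by congr fine; apply: eq_integral => x _; rewrite ReD.
rewrite ImD /= -rgood_integralD //.
by congr fine; apply: eq_integral => x _; rewrite ImD.
Qed.

Lemma CEZ c f : cgood f -> CE (fun x => c * f x) = c * CE f.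
Proof.
move=> [f1 f2]; apply: complex_eqP.
  rewrite ReM /= -mulNr -!rgood_integralZ // -rgood_integralD //; last 2 first.
  - by apply: rgoodM => //; exact: rgood_cst.
  - by apply: rgoodM => //; exact: rgood_cst.
  by congr fine; apply: eq_integral => x _; rewrite ReM mulNr.
rewrite ImM /= -!rgood_integralZ // -rgood_integralD //; last 2 first.
- by apply: rgoodM => //; exact: rgood_cst.
- by apply: rgoodM => //; exact: rgood_cst.
by congr fine; apply: eq_integral => x _; rewrite ImM.
Qed.

Lemma CE_sum I (s : seq I) (F : I -> T -> R[i]) : (forall q, cgood (F q)) ->
  CE (fun x => \sum_(q <- s) F q x) = \sum_(q <- s) CE (F q).
Proof.
move=> gF; elim: s => [|q s IH].
  by under eq_fun do rewrite big_nil; rewrite CE_cst big_nil.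
under eq_fun do rewrite big_cons.
by rewrite big_cons CED ?IH //; exact: cgood_sum.
Qed.

Lemma CE_lin I (s : seq I) (c : I -> R[i]) (F : I -> T -> R[i]) :
  (forall q, cgood (F q)) ->
  CE (fun x => \sum_(q <- s) c q * F q x) = \sum_(q <- s) c q * CE (F q).
Proof.
move=> gF; rewrite CE_sum => [|q]; last by apply: cgoodM => //; exact: cgood_cst.
by apply: eq_bigr => q _; rewrite CEZ.
Qed.

Lemma CE_ae f g : cgood f -> cgood g -> (forall x, W x -> f x = g x) -> CE f = CE g.
Proof.
move=> [[f1 _] [f2 _]] [[g1 _] [g2 _]] fg.
have ae (u v : T -> R) : measurable_fun setT u -> measurable_fun setT v ->
    (forall x, W x -> u x = v x) ->
    (\int[P]_x (u x)%:E = \int[P]_x (v x)%:E)%E.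
  move=> mu mv uv; apply: ae_eq_integral => //; try exact/measurable_EFinP.
  exists (~` W); split; [exact: measurableC|exact: full_setC0|].
  by move=> x /= h Wx; apply: h => _; rewrite uv.
by rewrite /CE; congr Complex; congr fine; apply: ae => // x Wx; rewrite fg.
Qed.

(** The pushforward of [P] under [phi] agrees with [P] on measurable sets, so this is a change of
    variables. No bound for [f] composed with [phi] is at hand; its integrability is transported
    from that of [f] through the pushforward of the absolute value. *)
Lemma CE_invariant (phi : T -> T) f : cgood f -> measurable_fun setT phi ->
  (forall E, measurable E -> P (phi @^-1` E) = P E) ->
  CE (fun x => f (phi x)) = CE f.
Proof.
move=> [f1 f2] mphi inv.
have key (u : T -> R) : rgood u ->
    (\int[P]_x (u (phi x))%:E = \int[P]_x (u x)%:E)%E.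
  move=> gu.
  have e : (\int[pushforward P phi]_x (u x)%:E = \int[P]_x (u x)%:E)%E.
    by apply: eq_measure_integral => A mA _; exact: inv.
  rewrite -e (@integral_pushforward _ _ _ _ _ phi mphi P setT (EFin \o u)) //.
    exact/measurable_EFinP/gu.1.
  have := rgood_integrable gu; move=> /integrableP[m1 fin1].
  apply/integrableP; split.
    apply: measurableT_comp => //; exact/measurable_EFinP/gu.1.
  have mu' : measurable_fun [set: T] (fun x => `|(u x)%:E|)%E.
    by apply: measurableT_comp => //; exact/measurable_EFinP/gu.1.
  have := @ge0_integral_pushforward _ _ _ _ _ phi mphi P setT (fun x => `|(u x)%:E|%E) measurableT mu' (fun _ _ => abse_ge0 _).
  rewrite preimage_setT => /= <-.
  rewrite (@eq_measure_integral _ _ _ setT P) // => A mA _.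
  exact: inv.
by rewrite /CE (key _ f1) (key _ f2).
Qed.

Definition aff I (c : R) (s : seq I) (w : I -> R) (X : I -> R[i]) : R :=
  c + \sum_(q <- s) w q * complex.Re (X q).

(** Linearity, together with total mass one, which leaves the constant term unchanged. *)
Lemma integral_aff I c (s : seq I) w (F : I -> T -> R[i]) :
  (forall q, cgood (F q)) ->
  (\int[P]_x (aff c s w (F^~ x))%:E = (aff c s w (fun q => CE (F q)))%:E)%E.
Proof.
move=> gF; rewrite /aff.
have gG t : rgood (fun x => \sum_(q <- t) w q * complex.Re (F q x)).
  elim: t => [|q t IH]; first by under eq_fun do rewrite big_nil; exact: rgood_cst.
  under eq_fun do rewrite big_cons.
  by apply: rgoodD => //; apply: rgoodM; [exact: rgood_cst|case: (gF q)].
rewrite -[LHS]fineK; last by apply: rgood_int_fin; apply: rgoodD => //; exact: rgood_cst.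
congr EFin; rewrite rgood_integralD //; last exact: rgood_cst.
congr (_ + _).
  by rewrite integral_prob_cst.
elim: s => [|q s IH].
  rewrite big_nil; under eq_integral do rewrite big_nil.
  by rewrite integral_prob_cst.
under eq_integral do rewrite big_cons.
rewrite rgood_integralD //; last first.
  by apply: rgoodM; [exact: rgood_cst|case: (gF q)].
by rewrite big_cons IH rgood_integralZ //; case: (gF q).
Qed.

End Expectation.

(** * Factoring quadruple sums *)

Lemma quad_sum (F : comNzRingType) I (s : seq I) (a b c e : I -> F) (X : I -> I -> I -> I -> F) :
  \sum_(k1 <- s) \sum_(k2 <- s) \sum_(k3 <- s) \sum_(k4 <- s)
     a k1 * b k2 * c k3 * e k4 * X k1 k2 k3 k4 =
  \sum_(k1 <- s) a k1 * \sum_(k2 <- s) b k2 * \sum_(k3 <- s) c k3 *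
     \sum_(k4 <- s) e k4 * X k1 k2 k3 k4.
Proof.
apply: eq_bigr => k1 _; rewrite mulr_sumr; apply: eq_bigr => k2 _.
rewrite mulr_sumr mulr_sumr; apply: eq_bigr => k3 _.
by rewrite !mulr_sumr; apply: eq_bigr => k4 _; rewrite !mulrA.
Qed.

Lemma prod_quad_sum (F : comNzRingType) I (s : seq I) (a b c e : I -> F) :
  (\sum_(k <- s) a k) * (\sum_(k <- s) b k) * (\sum_(k <- s) c k) * (\sum_(k <- s) e k) =
  \sum_(k1 <- s) \sum_(k2 <- s) \sum_(k3 <- s) \sum_(k4 <- s) a k1 * b k2 * c k3 * e k4.
Proof.
rewrite -!mulrA mulr_suml; apply: eq_bigr => k1 _.
rewrite mulr_suml mulr_sumr; apply: eq_bigr => k2 _.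
rewrite mulr_suml !mulr_sumr; apply: eq_bigr => k3 _.
by rewrite !mulr_sumr; apply: eq_bigr => k4 _; rewrite !mulrA.
Qed.

(** * Tensors of order four invariant under real orthogonal matrices *)

Section InvariantTensors.
Context (R : realType) (n : nat).
Local Notation C := R[i].
Local Notation "x %:C" := (real_complex R x).

(* The reflection along e_a + t e_b. All the symmetries needed are of this form: t = 0 flips the
   sign of e_a, t = -1 swaps e_a and e_b, and t = 2 sends e_a to (3 e_a - 4 e_b) / 5, a rational
   substitute for the 45 degree rotation. *)
Definition reflection_mx (a b : 'I_n) (t : R) : 'M[R]_n :=
  \matrix_(i, k) ((i == k)%:R - 2 / (1 + t ^+ 2) * ((i == a)%:R + t * (i == b)%:R)
                                   * ((k == a)%:R + t * (k == b)%:R)).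

(** A reflection differs from the identity by a rank-one matrix. The morphism [g] lets one formula
    serve over R, for orthogonality, and over R[i], for the action on tensors. *)
Lemma reflection_row (F : comNzRingType) (g : {rmorphism R -> F}) a b t i (f : 'I_n -> F) :
  \sum_k g (reflection_mx a b t i k) * f k =
  f i - g (2 / (1 + t ^+ 2) * ((i == a)%:R + t * (i == b)%:R)) * (f a + g t * f b).
Proof.
have pick j : \sum_k g (k == j)%:R * f k = f j.
  rewrite (bigD1 j) //= eqxx rmorph1 mul1r big1 ?addr0 // => k /negbTE ->.
  by rewrite rmorph0 mul0r.
rewrite -{1}(pick i) -{1}(pick a) -{1}(pick b) mulr_sumr -big_split /= mulr_sumr.
rewrite -sumrB; apply: eq_bigr => k _; rewrite mxE.
by rewrite rmorphB [in LHS]rmorphM [g (_ + t * (k == b)%:R)]rmorphD [g (t * (k == b)%:R)]rmorphM (eq_sym i k); ring.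
Qed.

Lemma reflection_orthogonal a b t : a != b -> orthogonal_mx (reflection_mx a b t).
Proof.
move=> ab; apply/matrixP => i j; rewrite !mxE.
under eq_bigr do rewrite [_^T _ _]mxE.
have := @reflection_row R (@idfun R) a b t i (fun k => reflection_mx a b t j k).
move=> /= ->; rewrite !mxE !eqxx (eq_sym b a) (negbTE ab) (eq_sym j i).
have h : 1 + t ^+ 2 != 0 by apply: lt0r_neq0; rewrite ltr_pwDl ?ltr01 ?sqr_ge0.
rewrite (_ : true%:R = 1 :> R) // (_ : false%:R = 0 :> R) //.
move: (i == j)%:R (i == a)%:R (i == b)%:R (j == a)%:R (j == b)%:R => u v w y z.
by field.
Qed.

(** [V'] acts on the last two slots, which hold conjugated entries; it will be the conjugate of [V],
    hence equal to [V] for real matrices. *)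
Definition tensor_invariant (V V' : 'M[C]_n) (X : 'I_n -> 'I_n -> 'I_n -> 'I_n -> C) :=
  forall i1 i2 i3 i4, X i1 i2 i3 i4 = \sum_k1 \sum_k2 \sum_k3 \sum_k4
     V i1 k1 * V i2 k2 * V' i3 k3 * V' i4 k4 * X k1 k2 k3 k4.

Variable X : 'I_n -> 'I_n -> 'I_n -> 'I_n -> C.
Hypothesis invX : forall V : 'M[R]_n, orthogonal_mx V ->
  tensor_invariant (map_mx (real_complex R) V) (map_mx (real_complex R) V) X.

(** Action of the reflection on a single slot; by [quad_sum] the action on the tensor is the
    fourfold nesting of it. *)
Let refl a b t i (f : 'I_n -> C) : C :=
  f i - (2 / (1 + t ^+ 2) * ((i == a)%:R + t * (i == b)%:R))%:C * (f a + t%:C * f b).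

Lemma invariant_reflection a b t i1 i2 i3 i4 : a != b ->
  X i1 i2 i3 i4 = refl a b t i1 (fun k1 => refl a b t i2 (fun k2 =>
    refl a b t i3 (fun k3 => refl a b t i4 (fun k4 => X k1 k2 k3 k4)))).
Proof.
move=> ab; rewrite {1}(invX (@reflection_orthogonal a b t ab)) quad_sum.
have rr i f : refl a b t i f =
    \sum_k map_mx (real_complex R) (reflection_mx a b t) i k * f k.
  by rewrite /refl -(@reflection_row _ (real_complex R)); apply: eq_bigr => k _; rewrite [(map_mx _ _) _ _]mxE.
rewrite rr; apply: eq_bigr => k1 _; congr (_ * _).
rewrite rr; apply: eq_bigr => k2 _; congr (_ * _).
rewrite rr; apply: eq_bigr => k3 _; congr (_ * _).
by rewrite rr.
Qed.

Lemma refl_sign a b i f : refl a b 0 i f = (-1) ^+ (i == a) * f i.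
Proof.
rewrite /refl expr0n /= addr0 divr1 mul0r addr0 rmorph0 mul0r addr0.
have [->|_] := eqVneq i a; last by rewrite mulr0 rmorph0 mul0r subr0 mul1r.
by rewrite mulr1 rmorph_nat expr1; ring.
Qed.

Lemma refl_swap a b i f : a != b -> refl a b (-1) i f = f (tperm a b i).
Proof.
move=> ab; rewrite /refl sqrrN expr1n divff ?mul1r ?pnatr_eq0 // !rmorphN1.
case: tpermP => [->|->|/eqP/negbTE-> /eqP/negbTE->].
- by rewrite eqxx (negbTE ab) mulr0 addr0 rmorph1; ring.
- by rewrite eqxx eq_sym (negbTE ab) add0r mulr1 rmorphN1; ring.
- by rewrite mulr0 addr0 rmorph0 mul0r subr0.
Qed.

Lemma invariant_tperm a b i1 i2 i3 i4 :
  X i1 i2 i3 i4 = X (tperm a b i1) (tperm a b i2) (tperm a b i3) (tperm a b i4).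
Proof.
have [->|ab] := eqVneq a b; first by rewrite tperm1 !perm1.
by rewrite (invariant_reflection (-1) i1 i2 i3 i4 ab) !refl_swap.
Qed.

Hypothesis n2 : (1 < n)%N.

Lemma exists_neq (a : 'I_n) : exists b, a != b.
Proof.
have n0 : (0 < n)%N by exact: ltnW.
have [->|h] := eqVneq a (Ordinal n0); last by exists (Ordinal n0).
by exists (Ordinal n2).
Qed.

(** Flipping the sign of e_a multiplies the entry by -1 to the number of slots equal to [a]. At t =
    0 the second index [b] only completes the data of a reflection, which must have a != b. *)
Lemma invariant_odd0 a i1 i2 i3 i4 :
  odd ((i1 == a) + (i2 == a) + (i3 == a) + (i4 == a)) -> X i1 i2 i3 i4 = 0.
Proof.
move=> hodd; have [b ab] := exists_neq a.
have := invariant_reflection 0 i1 i2 i3 i4 ab; rewrite !refl_sign !mulrA -!exprD.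
rewrite -signr_odd hodd expr1 => h.
have : 2 * X i1 i2 i3 i4 = 0 by rewrite mulrC mulr_natr mulr2n {2}h mulN1r subrr.
by move/eqP; rewrite mulf_eq0 pnatr_eq0 /= => /eqP.
Qed.

(** Two transpositions carry (i, j) to (o, p): the first sends i to o and j to some j', and since j'
    and p both differ from o, swapping j' with p leaves o in place. *)
Lemma invariant_pair (o p i j : 'I_n) : o != p -> i != j ->
  [/\ X i j i j = X o p o p, X i j j i = X o p p o & X i i j j = X o o p p].
Proof.
move=> op ij; set j' := tperm i o j.
have oj : o != j' by rewrite /j' -{1}(tpermL i o) (inj_eq perm_inj).
have h i1 i2 i3 i4 := invariant_tperm i o i1 i2 i3 i4.
have h' i1 i2 i3 i4 := invariant_tperm j' p i1 i2 i3 i4.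
have eo : tperm j' p o = o by rewrite tpermD // eq_sym.
split; rewrite h h' tpermL -/j' eo tpermL //.
Qed.

(** Permutations and signs never relate X o o o o to the mixed entries; a genuine rotation is
    needed, and the one with coefficients 3/5 and 4/5 stays rational. *)
Lemma invariant_diag (o p : 'I_n) : o != p ->
  X o o o o = X o p o p + X o p p o + X o o p p.
Proof.
move=> op; have po : p != o by rewrite eq_sym.
have z a i1 i2 i3 i4 h := @invariant_odd0 a i1 i2 i3 i4 h.
have e := invariant_reflection 2 o o o o op.
have step f : refl o p 2 o f = (3 / 5)%:C * f o - (4 / 5)%:C * f p.
  rewrite /refl eqxx (negbTE op) mulr0 addr0 mulr1.
  have -> : 3 / 5 = 1 - 2 / (1 + 2 ^+ 2) :> R by field.
  have -> : 4 / 5 = 2 / (1 + 2 ^+ 2) * 2 :> R by field.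
  by rewrite rmorphB [(_ / _ * 2)%:C]rmorphM rmorph1; ring.
rewrite !step in e.
have [s1 s2 s3] := invariant_pair op po.
have dd : X p p p p = X o o o o.
  by rewrite (invariant_tperm p o) tpermL.
(* Of the sixteen terms, the eight with an odd number of [o] vanish. There remain the two constant
   entries and six mixed ones, equal in pairs. *)
rewrite (z p o o o p) ?(z p o o p o) ?(z p o p o o) ?(z p p o o o) ?(z o o p p p)
  ?(z o p o p p) ?(z o p p o p) ?(z o p p p o) ?dd ?s1 ?s2 ?s3 in e;
  rewrite ?eqxx ?(negbTE op) ?(negbTE po) //.
move: e; rewrite ![in X in X -> _]fmorph_div ![in X in X -> _]rmorph_nat.
set A := X o o o o; set B1 := X o p o p; set B2 := X o p p o; set B3 := X o o p p.
(* Constant entries carry weight (3^4 + 4^4)/625 = 337/625, and each mixed type occurs twice with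
   weight 144/625. Hence (1 - 337/625) A = 288/625 (B1 + B2 + B3). *)
move=> e; apply: (@mulfI _ (288 / 625)).
  by rewrite mulf_neq0 ?invr_eq0 ?pnatr_eq0.
have -> : 288 / 625 * A = A - 337 / 625 * A by field.
by rewrite {1}e; field.
Qed.

(** Case analysis on coincidences. Either some value occurs an odd number of times, and both sides
    vanish; or the indices form two distinct pairs, and exactly one delta survives; or all are
    equal, all three deltas are 1, and [invariant_diag] applies. *)
Lemma invariant_tensorE (o p : 'I_n) i1 i2 i3 i4 : o != p ->
  X i1 i2 i3 i4 = X o p o p * ((i1 == i3) && (i2 == i4))%:R
                + X o p p o * ((i1 == i4) && (i2 == i3))%:R
                + X o o p p * ((i1 == i2) && (i3 == i4))%:R.
Proof.
move=> op.
have z a h := @invariant_odd0 a i1 i2 i3 i4 h.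
have [e12|n12] := eqVneq i1 i2.
  subst i2; have [e13|n13] := eqVneq i1 i3.
    subst i3; have [e14|n14] := eqVneq i1 i4.
      subst i4; have [b ib] := exists_neq i1.
      rewrite (invariant_diag ib) !mulr1.
      by have [-> -> ->] := invariant_pair op ib.
    by rewrite (z i4) ?eqxx ?(negbTE n14) // !mulr0 !addr0.
  have [e14|n14] := eqVneq i1 i4.
    subst i4; rewrite (z i3) ?eqxx ?(negbTE n13) //.
    by rewrite (eq_sym i3) (negbTE n13) !mulr0 !addr0.
  have [e34|n34] := eqVneq i3 i4.
    subst i4; have [_ _ ->] := invariant_pair op n13.
    by rewrite !mulr0 mulr1 !add0r.
  rewrite (z i3) ?eqxx ?(negbTE n13) ?(eq_sym i4) ?(negbTE n34) //.
  by rewrite !mulr0 !addr0.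
have [e13|n13] := eqVneq i1 i3.
  subst i3; have [e14|n14] := eqVneq i1 i4.
    subst i4; rewrite (z i2) ?eqxx ?(negbTE n12) //.
    by rewrite (eq_sym i2) (negbTE n12) !mulr0 !addr0.
  have [e24|n24] := eqVneq i2 i4.
    subst i4; have [-> _ _] := invariant_pair op n12.
    by rewrite !mulr0 mulr1 !addr0.
  rewrite (z i2) ?eqxx ?(negbTE n12) ?(eq_sym i4) ?(negbTE n24) //.
  by rewrite !mulr0 !addr0.
have [e14|n14] := eqVneq i1 i4.
  subst i4; have [e23|n23] := eqVneq i2 i3.
    subst i3; have [_ -> _] := invariant_pair op n12.
    by rewrite !mulr0 mulr1 !addr0 add0r.
  rewrite (z i2) ?eqxx ?(negbTE n12) ?(eq_sym i3) ?(negbTE n23) //.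
  by rewrite !mulr0 !addr0.
rewrite (z i1) ?eqxx ?(eq_sym i2) ?(eq_sym i3) ?(eq_sym i4) ?(negbTE n12) ?(negbTE n13) ?(negbTE n14) //.
by rewrite !mulr0 !addr0.
Qed.

End InvariantTensors.

(** * Fourth moments of a random matrix with a left-invariant law *)

Section Moments.
Context (R : realType) (dd : measure_display) (T : measurableType dd).
Variables (P : probability T R) (W : set T).
Hypotheses (mW : measurable W) (PW : P W = 1%E).
Context (n m : nat).
Variable Z : T -> 'M[R[i]]_(n, m).
Hypothesis gZ : forall i k, cgood W (fun t => Z t i k).

Definition moment i1 i2 i3 i4 k1 k2 k3 k4 : R[i] :=
  CE P (fun t => Z t i1 k1 * Z t i2 k2 * conjc (Z t i3 k3) * conjc (Z t i4 k4)).

(** The common interface for the sphere and both groups: left multiplication by [V] is realised by a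
    measure-preserving map of the sample space. *)
Definition left_invariant (V : 'M[R[i]]_n) := exists phi : T -> T,
  [/\ measurable_fun setT phi, forall E, measurable E -> P (phi @^-1` E) = P E
    & forall t, Z (phi t) = V *m Z t].

Lemma cgood_moment i1 i2 i3 i4 k1 k2 k3 k4 :
  cgood W (fun t => Z t i1 k1 * Z t i2 k2 * conjc (Z t i3 k3) * conjc (Z t i4 k4)).
Proof. by repeat apply: cgoodM => //; exact: cgoodJ. Qed.

(** Replacing [Z] by V Z does not change the expectation; expanding the four matrix products and
    pulling out the constants gives the tensor identity, with conjugated coefficients in the last
    two slots. *)
Lemma moment_invariant V k1 k2 k3 k4 : left_invariant V ->
  tensor_invariant V (map_mx (@conjc R) V)
    (fun i1 i2 i3 i4 => moment i1 i2 i3 i4 k1 k2 k3 k4).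
Proof.
move=> [phi [mphi Pphi Zphi]] i1 i2 i3 i4; rewrite /moment.
rewrite -(CE_invariant mW PW (cgood_moment i1 i2 i3 i4 k1 k2 k3 k4) mphi Pphi).
have -> : (fun x => Z (phi x) i1 k1 * Z (phi x) i2 k2 * conjc (Z (phi x) i3 k3) * conjc (Z (phi x) i4 k4))
  = fun x => \sum_l1 \sum_l2 \sum_l3 \sum_l4
     (V i1 l1 * V i2 l2 * map_mx (@conjc R) V i3 l3 * map_mx (@conjc R) V i4 l4) *
     (Z x l1 k1 * Z x l2 k2 * conjc (Z x l3 k3) * conjc (Z x l4 k4)).
  apply/funext => x; rewrite Zphi !mxE !rmorph_sum prod_quad_sum.
  apply: eq_bigr => l1 _; apply: eq_bigr => l2 _; apply: eq_bigr => l3 _; apply: eq_bigr => l4 _.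
  by rewrite !mxE !rmorphM; ring.
have g := cgood_moment.
rewrite (CE_sum mW PW) => [|l1]; last first.
  by do 3!(apply: cgood_sum => ?); apply: cgoodM => //; exact: cgood_cst.
apply: eq_bigr => l1 _; rewrite (CE_sum mW PW) => [|l2]; last first.
  by do 2!(apply: cgood_sum => ?); apply: cgoodM => //; exact: cgood_cst.
apply: eq_bigr => l2 _; rewrite (CE_sum mW PW) => [|l3]; last first.
  by do 1!(apply: cgood_sum => ?); apply: cgoodM => //; exact: cgood_cst.
by apply: eq_bigr => l3 _; rewrite (CE_lin mW PW).
Qed.

Hypothesis orthZ : forall V : 'M[R]_n, orthogonal_mx V ->
  left_invariant (map_mx (real_complex R) V).
Hypothesis n2 : (1 < n)%N.

Lemma momentE (o p : 'I_n) i1 i2 i3 i4 k1 k2 k3 k4 : o != p ->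
  moment i1 i2 i3 i4 k1 k2 k3 k4 =
    moment o p o p k1 k2 k3 k4 * ((i1 == i3) && (i2 == i4))%:R
  + moment o p p o k1 k2 k3 k4 * ((i1 == i4) && (i2 == i3))%:R
  + moment o o p p k1 k2 k3 k4 * ((i1 == i2) && (i3 == i4))%:R.
Proof.
move=> op; apply: (@invariant_tensorE _ _
  (fun i1 i2 i3 i4 => moment i1 i2 i3 i4 k1 k2 k3 k4)) => // V oV.
have := @moment_invariant _ k1 k2 k3 k4 (orthZ oV).
suff -> : map_mx (@conjc R) (map_mx (real_complex R) V) = map_mx (real_complex R) V by [].
by apply/matrixP => i j; rewrite !mxE conjc_real.
Qed.

Definition phase_mx (o : 'I_n) : 'M[R[i]]_n :=
  diag_mx (\row_k (if k == o then 'i%C else 1)).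

Lemma phase_mx_unitary o : unitary_mx (phase_mx o).
Proof.
rewrite /unitary_mx /phase_mx; apply/matrixP => i j.
rewrite mul_diag_mx !mxE [j == i]eq_sym.
have [->|_] := eqVneq i j; last by rewrite mulr0n rmorph0 mulr0.
rewrite mulr1n; case: eqP => _; last by rewrite rmorph1 mulr1.
by apply: complex_eqP; rewrite /= ?mul0r ?mulr0 ?mul1r ?opprK ?add0r ?addr0.
Qed.

(** The phase at [o] enters through the two unconjugated slots only, giving i^2 = -1, so the entry
    equals its opposite. A sign would not do, since its square is 1. *)
Lemma moment_phase (o p : 'I_n) k1 k2 k3 k4 : o != p -> left_invariant (phase_mx o) ->
  moment o o p p k1 k2 k3 k4 = 0.
Proof.
move=> op lo; have /= := @moment_invariant _ k1 k2 k3 k4 lo o o p p.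
have row i (f : 'I_n -> R[i]) : \sum_k phase_mx o i k * f k =
    (if i == o then 'i%C else 1) * f i.
  rewrite (bigD1 i) //= big1 ?addr0 => [|k /negbTE ki]; rewrite /phase_mx !mxE.
    by rewrite eqxx mulr1n.
  by rewrite (eq_sym i k) ki mulr0n mul0r.
have row' i (f : 'I_n -> R[i]) : \sum_k map_mx (@conjc R) (phase_mx o) i k * f k =
    conjc (if i == o then 'i%C else 1) * f i.
  rewrite (bigD1 i) //= big1 ?addr0 => [|k /negbTE ki]; rewrite /phase_mx !mxE.
    by rewrite eqxx mulr1n.
  by rewrite (eq_sym i k) ki mulr0n rmorph0 mul0r.
rewrite quad_sum row row row' row' eqxx eq_sym (negbTE op) rmorph1 !mul1r mulrA.
rewrite -expr2 sqr_i mulN1r => h.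
have : 2 * moment o o p p k1 k2 k3 k4 = 0 by rewrite mulrC mulr_natr mulr2n {2}h subrr.
by move/eqP; rewrite mulf_eq0 pnatr_eq0 /= => /eqP.
Qed.

(** The columns of [Z] are orthonormal on [W]; for a single column this says that it is a unit
    vector. *)
Definition isometric := forall t, W t -> forall k l,
  \sum_i Z t i k * conjc (Z t i l) = (k == l)%:R.

(** The double sum is constant only on [W], hence almost everywhere, which is enough for its
    expectation. *)
Lemma CE_pair_sum (F : 'I_n -> 'I_n -> T -> R[i]) c :
  (forall i j, cgood W (F i j)) -> (forall t, W t -> \sum_i \sum_j F i j t = c) ->
  \sum_i \sum_j CE P (F i j) = c.
Proof.
move=> gF Fc; rewrite -[RHS](CE_cst P c).
rewrite -(@CE_ae _ _ _ P W mW PW _ _ _ (cgood_cst W c) Fc); last first.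
  by do 2!(apply: cgood_sum => ?).
rewrite (CE_sum mW PW) => [|i]; last by apply: cgood_sum.
by apply: eq_bigr => i _; rewrite (CE_sum mW PW).
Qed.

Lemma moment_contract1 k1 k2 k3 k4 : isometric ->
  \sum_i \sum_j moment i j i j k1 k2 k3 k4 = ((k1 == k3) && (k2 == k4))%:R.
Proof.
move=> isoZ; apply: CE_pair_sum => [i j|t Wt]; first exact: cgood_moment.
rewrite -mulnb natrM -!(isoZ t Wt) mulr_suml; apply: eq_bigr => i _.
by rewrite mulr_sumr; apply: eq_bigr => j _; ring.
Qed.

Lemma moment_contract2 k1 k2 k3 k4 : isometric ->
  \sum_i \sum_j moment i j j i k1 k2 k3 k4 = ((k1 == k4) && (k2 == k3))%:R.
Proof.
move=> isoZ; apply: CE_pair_sum => [i j|t Wt]; first exact: cgood_moment.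
rewrite -mulnb natrM -!(isoZ t Wt) mulr_suml; apply: eq_bigr => i _.
by rewrite mulr_sumr; apply: eq_bigr => j _; ring.
Qed.

(** This pairing contracts [Z] with [Z] without conjugation; reality of the entries turns it back
    into an inner product of columns. *)
Lemma moment_contract3 k1 k2 k3 k4 : isometric ->
  (forall t i k, conjc (Z t i k) = Z t i k) ->
  \sum_i \sum_j moment i i j j k1 k2 k3 k4 = ((k1 == k2) && (k3 == k4))%:R.
Proof.
move=> isoZ rZ; apply: CE_pair_sum => [i j|t Wt]; first exact: cgood_moment.
rewrite -mulnb natrM -!(isoZ t Wt) mulr_suml; apply: eq_bigr => i _.
by rewrite mulr_sumr; apply: eq_bigr => j _; rewrite !rZ; ring.
Qed.

Variable Q : 'I_m -> 'I_m -> 'I_m -> 'I_m -> R[i].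

(** The column indices are contracted with a fixed tensor [Q]: the fourth moments of the input state
    for the groups, the constant 1 for the sphere. *)
Definition weighted_moment i1 i2 i3 i4 : R[i] :=
  \sum_k1 \sum_k2 \sum_k3 \sum_k4 Q k1 k2 k3 k4 * moment i1 i2 i3 i4 k1 k2 k3 k4.

Lemma weighted_momentE (o p : 'I_n) i1 i2 i3 i4 : o != p ->
  weighted_moment i1 i2 i3 i4 =
    weighted_moment o p o p * ((i1 == i3) && (i2 == i4))%:R
  + weighted_moment o p p o * ((i1 == i4) && (i2 == i3))%:R
  + weighted_moment o o p p * ((i1 == i2) && (i3 == i4))%:R.
Proof.
move=> op; rewrite /weighted_moment !mulr_suml -!big_split /=.
apply: eq_bigr => k1 _; rewrite !mulr_suml -!big_split /=.
apply: eq_bigr => k2 _; rewrite !mulr_suml -!big_split /=.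
apply: eq_bigr => k3 _; rewrite !mulr_suml -!big_split /=.
by apply: eq_bigr => k4 _; rewrite (momentE i1 i2 i3 i4 k1 k2 k3 k4 op); ring.
Qed.

Lemma weighted_moment_phase (o p : 'I_n) : o != p -> left_invariant (phase_mx o) ->
  weighted_moment o o p p = 0.
Proof.
move=> op lo; do 4!(apply: big1 => ? _).
by rewrite moment_phase // mulr0.
Qed.

(** [idx] encodes which row indices are identified and [b] the resulting condition on column
    indices, so that the three contractions share one exchange of sums. *)
Lemma weighted_pair_sum (idx : 'I_n -> 'I_n -> ('I_n * 'I_n * 'I_n * 'I_n))
    (b : 'I_m -> 'I_m -> 'I_m -> 'I_m -> bool) :
  (forall k1 k2 k3 k4, \sum_i \sum_j
     (let: (i1, i2, i3, i4) := idx i j in moment i1 i2 i3 i4 k1 k2 k3 k4) = (b k1 k2 k3 k4)%:R) ->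
  \sum_i \sum_j (let: (i1, i2, i3, i4) := idx i j in weighted_moment i1 i2 i3 i4) =
  \sum_k1 \sum_k2 \sum_k3 \sum_k4 Q k1 k2 k3 k4 * (b k1 k2 k3 k4)%:R.
Proof.
move=> h.
have -> : \sum_i \sum_j (let: (i1, i2, i3, i4) := idx i j in weighted_moment i1 i2 i3 i4) =
  \sum_i \sum_j \sum_k1 \sum_k2 \sum_k3 \sum_k4 Q k1 k2 k3 k4 *
    (let: (i1, i2, i3, i4) := idx i j in moment i1 i2 i3 i4 k1 k2 k3 k4).
  by apply: eq_bigr => i _; apply: eq_bigr => j _; case: (idx i j) => [[[i1 i2] i3] i4].
under eq_bigr do rewrite exchange_big /=; rewrite exchange_big /=.
apply: eq_bigr => k1 _.
under eq_bigr do rewrite exchange_big /=; rewrite exchange_big /=.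
apply: eq_bigr => k2 _.
under eq_bigr do rewrite exchange_big /=; rewrite exchange_big /=.
apply: eq_bigr => k3 _.
under eq_bigr do rewrite exchange_big /=; rewrite exchange_big /=.
apply: eq_bigr => k4 _.
rewrite -h mulr_sumr; apply: eq_bigr => i _.
by rewrite mulr_sumr.
Qed.

Lemma weighted_moment_contract1 : isometric ->
  \sum_i \sum_j weighted_moment i j i j = \sum_k \sum_l Q k l k l.
Proof.
move=> isoZ; rewrite (@weighted_pair_sum (fun i j => (i, j, i, j)) (fun k1 k2 k3 k4 => (k1 == k3) && (k2 == k4))); last first.
  by move=> k1 k2 k3 k4; exact: moment_contract1.
apply: eq_bigr => k _; apply: eq_bigr => l _.
rewrite (bigD1 k) //= (bigD1 l) //= !eqxx mulr1 !big1 ?addr0 //.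
  by move=> k3 /negbTE h; apply: big1 => k4 _; rewrite eq_sym h mulr0.
by move=> k4 /negbTE h; rewrite (eq_sym l) h andbF mulr0.
Qed.

Lemma weighted_moment_contract2 : isometric ->
  \sum_i \sum_j weighted_moment i j j i = \sum_k \sum_l Q k l l k.
Proof.
move=> isoZ; rewrite (@weighted_pair_sum (fun i j => (i, j, j, i)) (fun k1 k2 k3 k4 => (k1 == k4) && (k2 == k3))); last first.
  by move=> k1 k2 k3 k4; exact: moment_contract2.
apply: eq_bigr => k _; apply: eq_bigr => l _.
rewrite (bigD1 l) //= (bigD1 k) //= !eqxx mulr1 !big1 ?addr0 //.
  by move=> k3 /negbTE h; apply: big1 => k4 _; rewrite (eq_sym l) h andbF mulr0.
by move=> k4 /negbTE h; rewrite (eq_sym k) h mulr0.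
Qed.

Lemma weighted_moment_contract3 : isometric ->
  (forall t i k, conjc (Z t i k) = Z t i k) ->
  \sum_i \sum_j weighted_moment i i j j = \sum_k \sum_l Q k k l l.
Proof.
move=> isoZ rZ; rewrite (@weighted_pair_sum (fun i j => (i, i, j, j)) (fun k1 k2 k3 k4 => (k1 == k2) && (k3 == k4))); last first.
  by move=> k1 k2 k3 k4; exact: moment_contract3.
apply: eq_bigr => k _; rewrite (bigD1 k) //= [X in _ + X]big1 ?addr0 => [|k2 /negbTE h]; last first.
  by do 2!(apply: big1 => ? _); rewrite eq_sym h mulr0.
apply: eq_bigr => l _; rewrite (bigD1 l) //= !eqxx mulr1 big1 ?addr0 // => k4 /negbTE h.
by rewrite (eq_sym l) h mulr0.
Qed.

Lemma sum_pairings (a b c : R[i]) (x y z : 'I_n -> 'I_n -> bool) :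
  \sum_(i < n) \sum_(j < n) (a * (x i j)%:R + b * (y i j)%:R + c * (z i j)%:R) =
  a * \sum_(i < n) \sum_(j < n) (x i j)%:R + b * \sum_(i < n) \sum_(j < n) (y i j)%:R
   + c * \sum_(i < n) \sum_(j < n) (z i j)%:R.
Proof.
rewrite !mulr_sumr -!big_split /=; apply: eq_bigr => i _.
by rewrite !mulr_sumr -!big_split.
Qed.

Lemma sum_delta : \sum_(i < n) \sum_(j < n) ((i == j) && (i == j))%:R = n%:R :> R[i].
Proof.
transitivity (\sum_(i < n) 1 : R[i]); last by rewrite sumr_const card_ord.
apply: eq_bigr => i _; rewrite (bigD1 i) //= eqxx big1 ?addr0 // => j /negbTE h.
by rewrite eq_sym h.
Qed.

Lemma sum_delta_sym : \sum_(i < n) \sum_(j < n) ((i == j) && (j == i))%:R = n%:R :> R[i].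
Proof.
by rewrite -sum_delta; apply: eq_bigr => i _; apply: eq_bigr => j _; rewrite (eq_sym j).
Qed.

Lemma sum_true : \sum_(i < n) \sum_(j < n) ((i == i) && (j == j))%:R = n%:R * n%:R :> R[i].
Proof.
under eq_bigr => i _ do under eq_bigr => j _ do rewrite !eqxx.
by rewrite !sumr_const !card_ord -mulrnA natrM.
Qed.

(** Summing the pairing form over each pairing counts n^2 for the matching delta and n for the two
    others. The last two clauses are implications so that the same statement serves real matrices
    and phase-invariant laws. *)
Lemma weighted_moment_structure : isometric ->
  exists a b c : R[i],
  [/\ forall i1 i2 i3 i4, weighted_moment i1 i2 i3 i4 =
        a * ((i1 == i3) && (i2 == i4))%:R + b * ((i1 == i4) && (i2 == i3))%:R
        + c * ((i1 == i2) && (i3 == i4))%:R,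
      a * (n%:R * n%:R) + b * n%:R + c * n%:R = \sum_k \sum_l Q k l k l,
      a * n%:R + b * (n%:R * n%:R) + c * n%:R = \sum_k \sum_l Q k l l k,
      (forall t i k, conjc (Z t i k) = Z t i k) ->
        a * n%:R + b * n%:R + c * (n%:R * n%:R) = \sum_k \sum_l Q k k l l
    & (forall o, left_invariant (phase_mx o)) -> c = 0].
Proof.
move=> isoZ; have n0 : (0 < n)%N by exact: ltnW.
pose o := Ordinal n0; pose p := Ordinal n2.
have op : o != p by [].
exists (weighted_moment o p o p), (weighted_moment o p p o), (weighted_moment o o p p).
have E := fun i1 i2 i3 i4 => @weighted_momentE o p i1 i2 i3 i4 op.
split=> //.
- rewrite -weighted_moment_contract1 //; under eq_bigr => i _ do under eq_bigr => j _ do rewrite E.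
  by rewrite sum_pairings sum_delta sum_delta_sym sum_true.
- rewrite -weighted_moment_contract2 //; under eq_bigr => i _ do under eq_bigr => j _ do rewrite E.
  by rewrite sum_pairings sum_delta_sym sum_true; congr (_ + _ + _ * _); rewrite -sum_delta_sym.
- move=> rZ; rewrite -weighted_moment_contract3 //; under eq_bigr => i _ do under eq_bigr => j _ do rewrite E.
  by rewrite sum_pairings sum_delta sum_true.
- by move=> h; exact: weighted_moment_phase.
Qed.

End Moments.

(** * Multi-indices and their lexicographic positions *)

Lemma size_mindices ds : size (mindices ds) = (\prod_(e <- ds) e)%N.
Proof.
elim: ds => [|d ds IH]; first by rewrite big_nil.
by rewrite big_cons /= size_allpairs size_iota IH.
Qed.

(** Multi-indices with leading entry j fill the block of positions from j M to (j + 1) M - 1, where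
    M is the product of the remaining dimensions. Uniqueness, injectivity and the inverse
    [multi_index] all follow from this enumeration. *)
Lemma map_lin_index ds : map (lin_index ds) (mindices ds) = iota 0 (\prod_(e <- ds) e).
Proof.
elim: ds => [|d ds IH]; first by rewrite big_nil.
rewrite big_cons /= map_allpairs /=; move: (\prod_(e <- ds) e)%N IH => M IH.
have -> : [seq (j * M + lin_index ds js)%N | j <- iota 0 d, js <- mindices ds] =
    flatten [seq map (addn (j * M)) (iota 0 M) | j <- iota 0 d].
  by congr flatten; apply: eq_map => j; rewrite -IH -map_comp.
elim: d => [|d IHd] //; rewrite -addn1 iotaD map_cat flatten_cat IHd /= cats0 add0n.
by rewrite mulnDl mul1n iotaD -iotaDl addn0.
Qed.

Lemma mem_mindices ds j : (j \in mindices ds) = all2 ltn j ds.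
Proof.
elim: ds j => [|d ds IH] [|a j] //=.
  by apply/negbTE/allpairsP => -[[x y] [_ _]].
apply/allpairsP/andP => [[[x y] /= [hx hy [-> ->]]]|[ad jd]].
  by rewrite -IH hy; move: hx; rewrite mem_iota.
by exists (a, j); split; rewrite ?mem_iota //= IH.
Qed.

Lemma all2_ltn_nthP j ds : reflect
  (size j = size ds /\ forall i, (i < size ds)%N -> (nth 0%N j i < nth 0%N ds i)%N) (all2 ltn j ds).
Proof.
elim: ds j => [|d ds IH] [|a j] /=; try by constructor; case.
  by constructor.
apply: (iffP andP) => [[ad /IH[sz h]]|[[sz] h]].
  by split; [rewrite sz|case=> [|i] // /h].
split; first exact: (h 0%N).
by apply/IH; split => // i; exact: (h i.+1).
Qed.

Lemma uniq_mindices ds : uniq (mindices ds).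
Proof. by apply: (@map_uniq _ _ (lin_index ds)); rewrite map_lin_index iota_uniq. Qed.

Lemma lin_index_inj ds : {in mindices ds &, injective (lin_index ds)}.
Proof.
move=> x y hx hy e.
have U : uniq (map (lin_index ds) (mindices ds)) by rewrite map_lin_index iota_uniq.
have sx : (index x (mindices ds) < size (mindices ds))%N by rewrite index_mem.
have sy : (index y (mindices ds) < size (mindices ds))%N by rewrite index_mem.
rewrite -(nth_index [::] hx) -(nth_index [::] hy); congr (nth _ _ _).
apply/eqP; rewrite -(nth_uniq 0%N _ _ U) ?size_map //.
by rewrite !(nth_map [::]) // !nth_index // e.
Qed.

Lemma lin_index_lt ds j : j \in mindices ds -> (lin_index ds j < \prod_(e <- ds) e)%N.
Proof.
move=> /(map_f (lin_index ds)); rewrite map_lin_index mem_iota.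
by rewrite add0n => /andP[].
Qed.

Definition multi_index ds (i : nat) := nth [::] (mindices ds) i.

Lemma lin_multi_index ds i : (i < \prod_(e <- ds) e)%N -> lin_index ds (multi_index ds i) = i.
Proof.
move=> h; rewrite /multi_index.
have := nth_map [::] 0%N (lin_index ds) (s := mindices ds) (n := i).
by rewrite size_mindices map_lin_index nth_iota // add0n => /(_ h).
Qed.

Lemma sum_mindices (V : nmodType) ds n (F : seq nat -> V) : (\prod_(e <- ds) e)%N = n ->
  \sum_(k <- mindices ds) F k = \sum_(i < n) F (multi_index ds i).
Proof. by move=> <-; rewrite (big_nth [::]) big_mkord size_mindices. Qed.

(** Distributivity: this is what makes contractions of a product input factor over the sites. *)
Lemma sum_mindices_prod (F : comNzRingType) ds (f : nat -> nat -> F) :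
  \sum_(k <- mindices ds) \prod_(i < size ds) f i (nth 0%N k i) =
  \prod_(i < size ds) \sum_(j < nth 0%N ds i) f i j.
Proof.
elim: ds f => [|d ds IH] f; first by rewrite /= big_seq1 !big_ord0.
rewrite /= big_allpairs_dep big_ord_recl /= -(IH (fun i => f i.+1)).
rewrite mulr_suml -[RHS](big_mkord xpredT (fun j => f 0%N j * _)) /index_iota subn0.
apply: eq_bigr => j _; rewrite mulr_sumr; apply: eq_bigr => js _.
by rewrite big_ord_recl.
Qed.

Lemma sum_mindices_prod2 (F : comNzRingType) ds (f : nat -> nat -> nat -> F) :
  \sum_(k <- mindices ds) \sum_(l <- mindices ds)
    \prod_(i < size ds) f i (nth 0%N k i) (nth 0%N l i) =
  \prod_(i < size ds) \sum_(a < nth 0%N ds i) \sum_(b < nth 0%N ds i) f i a b.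
Proof.
under eq_bigr => k _ do rewrite (sum_mindices_prod ds (fun i => f i (nth 0%N k i))).
exact: (sum_mindices_prod ds (fun i a => \sum_(b < nth 0%N ds i) f i a b)).
Qed.

(** * Bipartite indices and the purity as a linear form on quartic tensors *)

Section Join.
Variables (N : nat) (d : nat -> nat) (A : seq nat).
Hypotheses (uA : uniq A) (AN : {subset A <= iota 0 N}).
Let B := [seq i <- iota 0 N | i \notin A].

Lemma nth_join a b i : (i < N)%N -> nth 0%N (join N A a b) i =
  if i \in A then nth 0%N a (index i A) else nth 0%N b (index i B).
Proof. by move=> iN; rewrite (nth_map 0%N) ?size_iota // nth_iota // add0n. Qed.

Lemma size_dims : size (dims N d) = N.
Proof. by rewrite size_map size_iota. Qed.

Lemma nth_dims i : (i < N)%N -> nth 0%N (dims N d) i = d i.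
Proof. by move=> iN; rewrite (nth_map 0%N) ?size_iota // nth_iota // add0n. Qed.

Lemma mem_join a b : a \in mindices (map d A) -> b \in mindices (map d B) ->
  join N A a b \in mindices (dims N d).
Proof.
rewrite !mem_mindices => /all2_ltn_nthP[sa ha] /all2_ltn_nthP[sb hb].
apply/all2_ltn_nthP; split; first by rewrite !size_map.
rewrite size_dims => i iN; rewrite nth_dims // nth_join //.
case: ifPn => iA.
  have h : (index i A < size A)%N by rewrite index_mem.
  by have := ha (index i A); rewrite size_map (nth_map 0%N) ?nth_index // => /(_ h).
have iB : i \in B by rewrite mem_filter iA mem_iota.
have h : (index i B < size B)%N by rewrite index_mem.
by have := hb (index i B); rewrite size_map (nth_map 0%N) ?nth_index // => /(_ h).
Qed.

(** [A] and [B] partition the sites, so both components can be read back from the joined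
    multi-index. *)
Lemma join_eq a b a' b' :
  a \in mindices (map d A) -> b \in mindices (map d B) ->
  a' \in mindices (map d A) -> b' \in mindices (map d B) ->
  (join N A a b == join N A a' b') = (a == a') && (b == b').
Proof.
rewrite !mem_mindices => /all2_ltn_nthP[sa _] /all2_ltn_nthP[sb _].
move=> /all2_ltn_nthP[sa' _] /all2_ltn_nthP[sb' _].
rewrite !size_map in sa sb sa' sb'.
apply/eqP/andP => [e|[/eqP-> /eqP->]] //.
have key i : (i < N)%N -> nth 0%N (join N A a b) i = nth 0%N (join N A a' b') i by rewrite e.
split; apply/eqP/(@eq_from_nth _ 0%N); rewrite ?sa ?sb ?sa' ?sb' // => i hi.
  have iA : nth 0%N A i \in A by exact: mem_nth.
  have iN : (nth 0%N A i < N)%N by have := AN iA; rewrite mem_iota.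
  by have := key _ iN; rewrite !nth_join // iA index_uniq.
have iB : nth 0%N B i \in B by exact: mem_nth.
have := iB; rewrite {1}/B mem_filter mem_iota add0n => /andP[/negbTE nA /andP[_ iN]].
by have := key _ iN; rewrite !nth_join // nA index_uniq // filter_uniq ?iota_uniq.
Qed.

(** Slots 1, 3 and slots 2, 4 agree on [B], by the partial trace; slots 1, 4 and slots 2, 3 agree on
    [A], by the trace of the square. *)
Definition purity_form (F : nmodType) (Y : seq nat -> seq nat -> seq nat -> seq nat -> F) : F :=
  \sum_(a <- mindices (map d A)) \sum_(a' <- mindices (map d A))
  \sum_(b <- mindices (map d B)) \sum_(b' <- mindices (map d B))
    Y (join N A a b) (join N A a' b') (join N A a' b) (join N A a b').

Lemma purityE (R : realType) (phi : seq nat -> R[i]) :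
  purity N d A phi = purity_form (fun j1 j2 j3 j4 => phi j1 * phi j2 * conjc (phi j3) * conjc (phi j4)).
Proof.
apply: eq_bigr => a _; apply: eq_bigr => a' _; rewrite mulr_suml.
apply: eq_bigr => b _; rewrite mulr_sumr; apply: eq_bigr => b' _.
by ring.
Qed.

Lemma sum_uniq_delta (F : comNzRingType) (s : seq (seq nat)) x : uniq s -> x \in s ->
  \sum_(y <- s) (x == y)%:R = 1 :> F.
Proof.
move=> us xs; rewrite (bigD1_seq x) //= eqxx big1 ?addr0 // => y.
by rewrite eq_sym => /negbTE ->.
Qed.

(** The first pairing forces a = a' and leaves a, b, b' free; the second forces b = b' and leaves a,
    a', b free; the third forces both. With D = dA dB the three weights are D dB, D dA and D. *)
Lemma purity_form_pairings (F : comNzRingType) (x y z : F)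
    (Y : seq nat -> seq nat -> seq nat -> seq nat -> F) :
  let dA := (\prod_(i <- A) d i)%:R in let dB := (\prod_(i <- B) d i)%:R in
  (forall j1 j2 j3 j4, j1 \in mindices (dims N d) -> j2 \in mindices (dims N d) ->
     j3 \in mindices (dims N d) -> j4 \in mindices (dims N d) ->
    Y j1 j2 j3 j4 = x * ((j1 == j3) && (j2 == j4))%:R
      + y * ((j1 == j4) && (j2 == j3))%:R + z * ((j1 == j2) && (j3 == j4))%:R) ->
  purity_form Y = x * (dA * (dB * dB)) + y * (dA * dA * dB) + z * (dA * dB).
Proof.
move=> dA dB YE.
pose sA := mindices (map d A); pose sB := mindices (map d B).
have uSA : uniq sA by exact: uniq_mindices.
have uSB : uniq sB by exact: uniq_mindices.
have dAE : \sum_(a <- sA) (1 : F) = dA.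
  by rewrite big_const_seq count_predT size_mindices big_map iter_addr_0.
have dBE : \sum_(a <- sB) (1 : F) = dB.
  by rewrite big_const_seq count_predT size_mindices big_map iter_addr_0.
transitivity (\sum_(a <- sA) \sum_(a' <- sA) \sum_(b <- sB) \sum_(b' <- sB)
   (x * (a == a')%:R + y * (b == b')%:R + z * ((a == a')%:R * (b == b')%:R))).
  rewrite /purity_form [LHS]big_seq [RHS]big_seq; apply: eq_bigr => a ha.
  rewrite [LHS]big_seq [RHS]big_seq; apply: eq_bigr => a' ha'.
  rewrite [LHS]big_seq [RHS]big_seq; apply: eq_bigr => b hb.
  rewrite [LHS]big_seq [RHS]big_seq; apply: eq_bigr => b' hb'.
  rewrite YE ?mem_join // !join_eq // !eqxx !andbT /=.
  rewrite (eq_sym a') (eq_sym b') !andbb.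
  by case: (a == a'); case: (b == b') => /=; rewrite ?mul1r ?mul0r.
have e1 a : a \in sA -> \sum_(a' <- sA) (a == a')%:R = 1 :> F by exact: sum_uniq_delta.
have e2 b : b \in sB -> \sum_(b' <- sB) (b == b')%:R = 1 :> F by exact: sum_uniq_delta.
have inner (a a' : seq nat) : \sum_(b <- sB) \sum_(b' <- sB)
   (x * (a == a')%:R + y * (b == b')%:R + z * ((a == a')%:R * (b == b')%:R)) =
   x * (dB * dB) * (a == a')%:R + y * dB + z * dB * (a == a')%:R.
  transitivity (\sum_(b <- sB) (x * (a == a')%:R * dB + y + z * (a == a')%:R)).
    rewrite [LHS]big_seq [RHS]big_seq; apply: eq_bigr => b hb.
    rewrite !big_split /= -!mulr_sumr e2 // !mulr1; congr (_ + _ + _).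
    by rewrite -mulrA -dBE; congr (_ * _); rewrite mulr_sumr; apply: eq_bigr => ? _; rewrite mulr1.
  rewrite -[X in \sum_(b <- _) X]mulr1 -mulr_sumr dBE; ring.
under eq_bigr do under eq_bigr do rewrite inner.
transitivity (\sum_(a <- sA) (x * (dB * dB) + y * dB * dA + z * dB)).
  rewrite [LHS]big_seq [RHS]big_seq; apply: eq_bigr => a ha.
  rewrite !big_split /= -!mulr_sumr e1 // !mulr1; congr (_ + _ + _).
  by rewrite -mulrA -dAE; congr (_ * _); rewrite mulr_sumr; apply: eq_bigr => ? _; rewrite mulr1.
rewrite -[X in \sum_(b <- _) X]mulr1 -mulr_sumr dAE; ring.
Qed.

End Join.

(** * Measurability of equations and bounds on unit vectors *)

Section Measurability.
Context (R : realType) (dd : measure_display) (T : measurableType dd).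

Lemma measurable_forall_ord n (A : 'I_n -> set T) : (forall i, measurable (A i)) ->
  measurable [set t | forall i, A i t].
Proof.
move=> mA; rewrite (_ : [set t | _] = \bigcap_(i in [set: 'I_n]) A i).
  by apply: fin_bigcap_measurable => // i _.
by apply/seteqP; split => t /= h; [move=> i _; exact: h|move=> i; exact: h].
Qed.

Lemma measurable_eq_cst (f : T -> R) c : measurable_fun setT f -> measurable [set t | f t = c].
Proof.
move=> mf; rewrite -[X in measurable X]setTI.
by have := mf measurableT _ (measurable_set1 c).
Qed.

(* Boundedness on set0 is vacuous, so [cgood set0] is plain measurability of both parts. *)
Lemma measurable_ceq_cst (f : T -> R[i]) c : cgood set0 f -> measurable [set t | f t = c].
Proof.
move=> [[mr _] [mi _]].
rewrite (_ : [set t | _] = [set t | complex.Re (f t) = complex.Re c] `&`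
                           [set t | complex.Im (f t) = complex.Im c]).
  by apply: measurableI; exact: measurable_eq_cst.
by apply/seteqP; split=> [t /= -> //|t /= [h1 h2]]; exact: complex_eqP.
Qed.

Lemma cgood0P (f : T -> R[i]) : measurable_fun setT (fun t => complex.Re (f t)) ->
  measurable_fun setT (fun t => complex.Im (f t)) -> cgood set0 f.
Proof. by move=> mr mi; split; split=> //; exists 0. Qed.

Lemma sqr_le1_norm (x : R) : x ^+ 2 <= 1 -> `|x| <= 1.
Proof. by move=> h; rewrite -(@ler_pXn2r _ 2) ?nnegrE // expr1n real_normK ?num_real. Qed.

Lemma cgood_unit_row (W : set T) m (f : 'I_m -> T -> R[i]) k : (forall k, cgood set0 (f k)) ->
  (forall t, W t -> \sum_k f k t * conjc (f k t) = 1) -> cgood W (f k).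
Proof.
move=> gf h.
have nn (z : R[i]) : complex.Re (z * conjc z) = complex.Re z ^+ 2 + complex.Im z ^+ 2.
  by rewrite ReM Re_conj Im_conj mulrN opprK.
have b t : W t -> complex.Re (f k t) ^+ 2 + complex.Im (f k t) ^+ 2 <= 1.
  move=> Wt; have /(congr1 (@complex.Re R)) := h t Wt.
  rewrite Re_sum => /= <-; rewrite (bigD1 k) //= nn lerDl.
  by apply: sumr_ge0 => j _; rewrite nn addr_ge0 ?sqr_ge0.
have [[mr _] [mi _]] := gf k.
split; split=> //; exists 1 => t Wt; apply: sqr_le1_norm; apply: le_trans (b t Wt).
  by rewrite lerDl sqr_ge0.
by rewrite lerDr sqr_ge0.
Qed.

End Measurability.

(** * Unitary matrices by rows and columns *)

Section Unitary.
Context (R : realType) (n : nat).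

Lemma unitary_rows (V : 'M[R[i]]_n) : unitary_mx V <->
  forall i j, \sum_k V i k * conjc (V j k) = (i == j)%:R.
Proof.
split=> [/matrixP h i j|h].
  by have := h i j; rewrite !mxE => <-; apply: eq_bigr => k _; rewrite !mxE.
by apply/matrixP => i j; rewrite !mxE -h; apply: eq_bigr => k _; rewrite !mxE.
Qed.

(** A one-sided inverse of a square matrix is two-sided, so orthonormal rows yield the orthonormal
    columns that [isometric] asks for. *)
Lemma unitary_cols (V : 'M[R[i]]_n) : unitary_mx V ->
  forall k l, \sum_i V i k * conjc (V i l) = (k == l)%:R.
Proof.
move=> /mulmx1C/matrixP h k l; have := h l k; rewrite !mxE eq_sym => <-.
by apply: eq_bigr => i _; rewrite !mxE mulrC.
Qed.

Lemma orthogonal_unitary (O : 'M[R]_n) : orthogonal_mx O -> unitary_mx (map_mx (real_complex R) O).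
Proof.
rewrite /unitary_mx => h.
have -> : map_mx (@conjc R) (map_mx (real_complex R) O) = map_mx (real_complex R) O.
  by apply/matrixP => i j; rewrite !mxE conjc_real.
by rewrite map_trmx -map_mxM h map_mx1.
Qed.

End Unitary.

(** * The uniform law on the unit sphere of C^d *)

Section Sphere.
Context (R : realType) (d : nat) (nu : probability ((d + d).-tuple R) R).
Hypothesis Hnu : uniform_sphere nu.

Definition sphere : set ((d + d).-tuple R) := [set t | \sum_(k < d + d) tnth t k ^+ 2 = 1].

Definition sphere_coord (t : (d + d).-tuple R) : 'M[R[i]]_(d, 1) :=
  \matrix_(i, j) Complex (tnth t (lshift d i)) (tnth t (rshift d i)).

Lemma cgood0_sphere_coord i k : cgood set0 (fun t => sphere_coord t i k).
Proof.
apply: cgood0P; under eq_fun do rewrite mxE /=; exact: measurable_tnth.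
Qed.

Lemma sphere_isometric : isometric sphere sphere_coord.
Proof.
move=> t Wt k l; rewrite !ord1 eqxx; apply: complex_eqP.
  transitivity (1 : R) => //; move: Wt; rewrite /sphere /= => Wt; rewrite Re_sum -Wt big_split_ord /= -big_split /=; apply: eq_bigr => i _.
  by rewrite mxE /= mulrN opprK !expr2.
elim/big_ind: _ => //= [x y hx hy|i _]; first by rewrite ImD hx hy addr0.
by rewrite mxE /= mulrN mulrC addNr.
Qed.

Lemma cgood_sphere_coord i k : cgood sphere (fun t => sphere_coord t i k).
Proof.
apply: (@cgood_unit_row _ _ _ sphere d (fun i t => sphere_coord t i k)) => [j|t Wt].
  exact: cgood0_sphere_coord.
by rewrite (sphere_isometric Wt) eqxx.
Qed.

Lemma measurable_sphere : measurable sphere.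
Proof.
have := @measurable_ceq_cst _ _ _ (fun t => \sum_i sphere_coord t i 0 * conjc (sphere_coord t i 0)) 1.
rewrite (_ : [set t | _] = sphere).
  apply; apply: cgood_sum => i; apply: cgoodM; last apply: cgoodJ; exact: cgood0_sphere_coord.
apply/seteqP; split => t /=; last by move=> /sphere_isometric ->; rewrite eqxx.
move=> /(congr1 (@complex.Re R)); rewrite Re_sum /= /sphere /= => <-.
rewrite big_split_ord /= -big_split /=; apply: eq_bigr => i _.
by rewrite mxE /= mulrN opprK !expr2.
Qed.

Lemma sphere_prob : nu sphere = 1%E.
Proof. by case: Hnu. Qed.

(** The standard embedding of U(d) into O(2d), in the coordinates that list real parts before
    imaginary parts. *)
Definition realify (V : 'M[R[i]]_d) : 'M[R]_(d + d) :=
  block_mx (map_mx (@complex.Re R) V) (- map_mx (@complex.Im R) V)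
           (map_mx (@complex.Im R) V) (map_mx (@complex.Re R) V).

(** The diagonal blocks are the real part of the orthonormality of rows, the off-diagonal ones its
    imaginary part up to sign. *)
Lemma realify_orthogonal V : unitary_mx V -> orthogonal_mx (realify V).
Proof.
move=> /unitary_rows uV; rewrite /orthogonal_mx /realify tr_block_mx mulmx_block scalar_mx_block.
have re i j : \sum_k complex.Re (V i k) * complex.Re (V j k)
            + \sum_k complex.Im (V i k) * complex.Im (V j k) = (i == j)%:R.
  rewrite -big_split /=; have /(congr1 (@complex.Re R)) := uV i j; rewrite Re_sum.
  rewrite -(rmorph_nat (real_complex R)) /= => <-; apply: eq_bigr => k _.
  by rewrite ReM Re_conj Im_conj mulrN opprK.
have im i j : \sum_k complex.Im (V i k) * complex.Re (V j k)
            - \sum_k complex.Re (V i k) * complex.Im (V j k) = 0.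
  rewrite -sumrB; have /(congr1 (@complex.Im R)) := uV i j.
  have -> : \sum_k V i k * conjc (V j k) = 
     Complex (\sum_k (complex.Re (V i k) * complex.Re (V j k) + complex.Im (V i k) * complex.Im (V j k)))
       (\sum_k (complex.Im (V i k) * complex.Re (V j k) - complex.Re (V i k) * complex.Im (V j k))).
    elim: (index_enum _) => [|k s IH]; first by rewrite !big_nil.
    rewrite !big_cons IH; apply: complex_eqP; rewrite ?ReD ?ImD ?ReM ?ImM Re_conj Im_conj /=; ring.
  by rewrite -(rmorph_nat (real_complex R)).
congr block_mx; apply/matrixP => i j; rewrite !mxE.
- by rewrite -re; congr (_ + _); apply: eq_bigr => k _; rewrite !mxE ?mulrNN.
- apply: etrans (etrans (esym (opprB _ _)) (etrans (congr1 -%R (im i j)) (oppr0 _))); congr (_ + _); last rewrite -sumrN.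
    by apply: eq_bigr => k _; rewrite !mxE.
  by apply: eq_bigr => k _; rewrite !mxE mulNr.
- apply: etrans (im i j); congr (_ + _); last rewrite -sumrN.
    by apply: eq_bigr => k _; rewrite !mxE.
  by apply: eq_bigr => k _; rewrite !mxE mulrN.
- by rewrite -re addrC; congr (_ + _); apply: eq_bigr => k _; rewrite !mxE.
Qed.

Lemma sphere_left_invariant V : unitary_mx V -> left_invariant nu sphere_coord V.
Proof.
move=> uV; exists (fun t => [tuple \sum_l realify V k l * tnth t l | k < d + d]); split.
- apply/measurable_fun_tnthP => k.
  rewrite (_ : _ \o _ = fun t => \sum_l realify V k l * tnth t l); last first.
    by apply/funext => t /=; rewrite tnth_mktuple.
  apply: measurable_sum => l; apply: measurable_funM => //; exact: measurable_tnth.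
- by case: Hnu => _; apply; exact: realify_orthogonal.
move=> t; apply/matrixP => i k; rewrite !mxE !tnth_mktuple !big_split_ord /=.
have -> : \sum_j V i j * sphere_coord t j k = 
  Complex (\sum_j (complex.Re (V i j) * tnth t (lshift d j) - complex.Im (V i j) * tnth t (rshift d j)))
   (\sum_j (complex.Re (V i j) * tnth t (rshift d j) + complex.Im (V i j) * tnth t (lshift d j))).
  elim: (index_enum _) => [|j s IH]; first by rewrite !big_nil.
  by rewrite !big_cons IH mxE; apply: complex_eqP; rewrite ?ReD ?ImD ?ReM ?ImM.
rewrite -!big_split /=; congr Complex; apply: eq_bigr => j _.
  by rewrite block_mxEul block_mxEur !mxE mulNr.
by rewrite block_mxEdl block_mxEdr !mxE addrC.
Qed.

End Sphere.

Definition quartic (R : realType) (psi : seq R[i]) (a b c e : nat) : R[i] :=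
  nth 0 psi a * nth 0 psi b * conjc (nth 0 psi c) * conjc (nth 0 psi e).

Section SphereMoments.
Context (R : realType) (d : nat) (nu : probability ((d + d).-tuple R) R).
Hypotheses (Hnu : uniform_sphere nu) (d2 : (1 < d)%N).

Definition sphere_moment (a b c e : nat) : R[i] :=
  CE nu (fun x => quartic (cvec_of_tuple x) a b c e).

Lemma nth_cvec (x : (d + d).-tuple R) (a : 'I_d) :
  nth 0 (cvec_of_tuple x) a = sphere_coord x a 0.
Proof. by rewrite mxE (nth_map a) ?size_enum_ord // nth_ord_enum. Qed.

Lemma cgood_nth_cvec a : cgood (@sphere R d) (fun x : (d + d).-tuple R => nth 0 (cvec_of_tuple x) a).
Proof.
have [ad|da] := ltnP a d.
  rewrite (_ : (fun _ => _) = fun x => sphere_coord x (Ordinal ad) 0).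
    exact: cgood_sphere_coord.
  by apply/funext => x; rewrite -nth_cvec.
rewrite (_ : (fun _ => _) = fun=> 0); first exact: cgood_cst.
by apply/funext => x; rewrite nth_default // size_map size_enum_ord.
Qed.

Lemma cgood_quartic a b c e :
  cgood (@sphere R d) (fun x : (d + d).-tuple R => quartic (cvec_of_tuple x) a b c e).
Proof. by repeat apply: cgoodM; rewrite //; try apply: cgoodJ; exact: cgood_nth_cvec. Qed.

(** Invariance under all of U(d) kills the third coefficient, and the normalisations give 1 / (d (d
    + 1)) for the other two. The last contraction is not fixed by the norm: it is 2 d times this
    coefficient. *)
Lemma sphere_moment_contract :
  [/\ \sum_(a < d) \sum_(b < d) sphere_moment a b a b = 1,
      \sum_(a < d) \sum_(b < d) sphere_moment a b b a = 1
    & \sum_(a < d) \sum_(b < d) sphere_moment a a b b = 2 / (d%:R + 1)].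
Proof.
have mE (a b c e : 'I_d) : sphere_moment a b c e = weighted_moment nu (@sphere_coord R d) (fun _ _ _ _ => 1) a b c e.
  rewrite /weighted_moment !big_ord1 mul1r /moment /sphere_moment /quartic.
  by under eq_fun do rewrite !nth_cvec.
have mS := @measurable_sphere R d; have S1 := sphere_prob Hnu.
have orth V : orthogonal_mx V -> left_invariant nu (@sphere_coord R d) (map_mx (real_complex R) V).
  by move=> /orthogonal_unitary; exact: sphere_left_invariant.
have := @weighted_moment_structure _ _ _ nu _ mS S1 d 1 _ (@cgood_sphere_coord R d)
  orth d2 (fun _ _ _ _ => 1) (@sphere_isometric R d).
move=> [x [y [z [E e1 e2 _ z0]]]].
have {}z0 : z = 0 by apply: z0 => o; apply: sphere_left_invariant => //; exact: phase_mx_unitary.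
rewrite !big_ord1 z0 mul0r addr0 in e1; rewrite !big_ord1 z0 mul0r addr0 in e2.
have dn0 : (d%:R : R[i]) != 0 by rewrite pnatr_eq0 -lt0n ltnW.
have d1n0 : (d%:R + 1 : R[i]) != 0 by rewrite natr1 pnatr_eq0.
have dm0 : (d%:R - 1 : R[i]) != 0.
  by rewrite subr_eq0 (eqr_nat _ d 1) gtn_eqF.
(* The difference of the two normalisations is (x - y) d (d - 1), and d > 1. *)
have xy : x = y.
  have : (x - y) * (d%:R * (d%:R - 1)) = 0.
    transitivity (x * (d%:R * d%:R) + y * d%:R - (x * d%:R + y * (d%:R * d%:R))); first by ring.
    by rewrite e1 e2 subrr.
  by move/eqP; rewrite mulf_eq0 mulf_eq0 (negbTE dn0) (negbTE dm0) !orbF subr_eq0 => /eqP.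
rewrite -xy in e1 E.
have hx : x = 1 / (d%:R * (d%:R + 1)).
  apply: (@mulIf _ (d%:R * (d%:R + 1))); first by rewrite mulf_neq0.
  by rewrite divfK ?mulf_neq0 // -[RHS]e1; ring.
have EE (a b c e : 'I_d) : sphere_moment a b c e =
   x * ((a == c) && (b == e))%:R + x * ((a == e) && (b == c))%:R + 0 * ((a == b) && (c == e))%:R.
  by rewrite mE E z0.
split.
- under eq_bigr => a _ do under eq_bigr => b _ do rewrite EE.
  by rewrite sum_pairings sum_delta sum_delta_sym sum_true mul0r addr0 -[RHS]e1.
- under eq_bigr => a _ do under eq_bigr => b _ do rewrite EE.
  rewrite sum_pairings sum_true mul0r addr0 -[RHS]e1 addrC; congr (_ + _ * _).
  exact: sum_delta_sym.
- under eq_bigr => a _ do under eq_bigr => b _ do rewrite EE.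
  rewrite sum_pairings sum_delta mul0r addr0 hx; field.
  by rewrite dn0 d1n0.
Qed.

End SphereMoments.

(** * Haar measures on the orthogonal and unitary groups *)

Section Haar.
Context (R : realType) (n : nat).

Lemma rmx_of_tupleK (M : 'M[R]_n) : rmx_of_tuple (tuple_of_rmx M) = M.
Proof. by apply/matrixP => i j; rewrite mxE tnth_mktuple mxvecE. Qed.

Lemma cmx_of_tupleK (M : 'M[R[i]]_n) : cmx_of_tuple (tuple_of_cmx M) = M.
Proof.
apply/matrixP => i j; rewrite mxE !tnth_mktuple.
rewrite (unsplitK (inl (mxvec_index i j))) (unsplitK (inr (mxvec_index i j))) mxvecE.
by case: (M i j).
Qed.

Lemma cgood0_cmx_of_tuple i j :
  cgood set0 (fun t : (n * n + n * n).-tuple R => cmx_of_tuple t i j).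
Proof. by apply: cgood0P; under eq_fun do rewrite mxE /=; exact: measurable_tnth. Qed.

Lemma cgood0_rmx_of_tuple i j :
  cgood set0 (fun t : (n * n).-tuple R => map_mx (real_complex R) (rmx_of_tuple t) i j).
Proof.
apply: cgood0P; under eq_fun do rewrite !mxE /=; first exact: measurable_tnth.
exact: measurable_cst.
Qed.

Lemma measurable_unitary (dd : measure_display) (T : measurableType dd) (Z : T -> 'M[R[i]]_n) :
  (forall i j, cgood set0 (fun t => Z t i j)) -> measurable [set t | unitary_mx (Z t)].
Proof.
move=> gZ; rewrite (_ : [set t | _] =
   [set t | forall i, forall j, \sum_k Z t i k * conjc (Z t j k) = (i == j)%:R]); last first.
  by apply/seteqP; split => t /= /unitary_rows.
apply: measurable_forall_ord => i; apply: measurable_forall_ord => j.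
apply: (@measurable_ceq_cst _ _ _ (fun t => \sum_k Z t i k * conjc (Z t j k))).
by apply: cgood_sum => k; apply: cgoodM => //; exact: cgoodJ.
Qed.

Lemma cgood_unitary (dd : measure_display) (T : measurableType dd) (Z : T -> 'M[R[i]]_n) i j :
  (forall i j, cgood set0 (fun t => Z t i j)) ->
  cgood [set t | unitary_mx (Z t)] (fun t => Z t i j).
Proof.
move=> gZ; apply: (@cgood_unit_row _ _ _ _ _ (fun j t => Z t i j)) => // t.
by move=> /= /unitary_rows ->; rewrite eqxx.
Qed.

Lemma unitary_isometric (dd : measure_display) (T : measurableType dd) (Z : T -> 'M[R[i]]_n) :
  isometric [set t | unitary_mx (Z t)] Z.
Proof. by move=> t /= /unitary_cols. Qed.

(** Measurability, bounds and orthonormal columns of the orthogonal case are thereby inherited from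
    the unitary one. *)
Lemma orthogonal_set : [set t : (n * n).-tuple R | orthogonal_mx (rmx_of_tuple t)] =
  [set t | unitary_mx (map_mx (real_complex R) (rmx_of_tuple t))].
Proof.
apply/seteqP; split => t /=; first exact: orthogonal_unitary.
move=> /unitary_rows h; apply/matrixP => i j; rewrite !mxE.
apply: (@complexI R); rewrite rmorph_sum rmorph_nat -h; apply: eq_bigr => k _.
by rewrite !mxE rmorphM conjc_real.
Qed.

Lemma haar_orthogonal_invariant (mu : probability ((n * n).-tuple R) R) (V : 'M[R]_n) :
  Haar_orthogonal mu -> orthogonal_mx V ->
  left_invariant mu (fun t => map_mx (real_complex R) (rmx_of_tuple t)) (map_mx (real_complex R) V).
Proof.
move=> [_ inv] oV; exists (fun t => tuple_of_rmx (V *m rmx_of_tuple t)); split.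
- apply/measurable_fun_tnthP => k.
  have [i j] := mxvec_indexP k.
  rewrite (_ : _ \o _ = fun t => \sum_l V i l * tnth t (mxvec_index l j)).
    by apply: measurable_sum => l; apply: measurable_funM => //; exact: measurable_tnth.
  by apply/funext => t /=; rewrite tnth_mktuple mxvecE mxE; apply: eq_bigr => l _; rewrite mxE.
- exact: inv.
- by move=> t; rewrite rmx_of_tupleK map_mxM.
Qed.

Lemma haar_unitary_invariant (mu : probability ((n * n + n * n).-tuple R) R) (V : 'M[R[i]]_n) :
  Haar_unitary mu -> unitary_mx V -> left_invariant mu (@cmx_of_tuple R n) V.
Proof.
move=> [_ inv] uV; exists (fun t => tuple_of_cmx (V *m cmx_of_tuple t)); split.
- have g i j : cgood set0 (fun t : (n * n + n * n).-tuple R => (V *m cmx_of_tuple t) i j).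
    under eq_fun do rewrite mxE; apply: cgood_sum => k.
    by apply: cgoodM; [exact: cgood_cst|exact: cgood0_cmx_of_tuple].
  apply/measurable_fun_tnthP => k; rewrite /comp.
  under eq_fun do rewrite tnth_mktuple.
  case: (fintype.split k) => a; have [i j] := mxvec_indexP a.
    by under eq_fun do rewrite mxvecE; have [[]] := g i j.
  by under eq_fun do rewrite mxvecE; have [_ []] := g i j.
- exact: inv.
- by move=> t; rewrite cmx_of_tupleK.
Qed.

End Haar.

(** * Affine functionals of a tensor *)

Section Affine.
Context (R : realType) (I : Type).

(** The index type may be infinite, so the finite list [s] records the only entries that [L] reads;
    this is what lets [L] commute with integrals. *)
Definition affine (L : (I -> R[i]) -> R) :=
  exists (c : R) (s : seq (R * I)), forall X, L X = aff c s fst (fun q => X q.2).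

Lemma affine_cst c : affine (fun=> c).
Proof. by exists c, [::] => X; rewrite /aff big_nil addr0. Qed.

Lemma affine_Re q : affine (fun X => complex.Re (X q)).
Proof. by exists 0, [:: (1, q)] => X; rewrite /aff big_seq1 add0r mul1r. Qed.

Lemma affineD L1 L2 : affine L1 -> affine L2 -> affine (fun X => L1 X + L2 X).
Proof.
move=> [c1 [s1 h1]] [c2 [s2 h2]]; exists (c1 + c2), (s1 ++ s2) => X.
by rewrite h1 h2 /aff big_cat /= addrACA.
Qed.

Lemma affineZ r L : affine L -> affine (fun X => r * L X).
Proof.
move=> [c [s h]]; exists (r * c), [seq (r * q.1, q.2) | q <- s] => X.
rewrite h /aff big_map mulrDr mulr_sumr; congr (_ + _).
by apply: eq_bigr => q _; rewrite mulrA.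
Qed.

Lemma affine_sum J (s : seq J) (p : pred J) (L : J -> (I -> R[i]) -> R) :
  (forall j, affine (L j)) -> affine (fun X => \sum_(j <- s | p j) L j X).
Proof.
move=> aL; elim: s => [|j s IH].
  by under eq_fun do rewrite big_nil; exact: affine_cst.
under eq_fun do rewrite big_cons.
case: (p j) => //; exact: affineD.
Qed.

Lemma integral_affine (dd : measure_display) (T : measurableType dd) (P : probability T R)
    (W : set T) (L : (I -> R[i]) -> R) (F : I -> T -> R[i]) :
  measurable W -> P W = 1%E -> affine L -> (forall q, cgood W (F q)) ->
  (\int[P]_x (L (F^~ x))%:E = (L (fun q => CE P (F q)))%:E)%E.
Proof.
move=> mW PW [c [s h]] gF; rewrite h.
rewrite -(@integral_aff _ _ _ P W mW PW _ c s fst (fun q => F q.2)) //.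
by apply: eq_integral => x _; rewrite h.
Qed.

End Affine.

Definition tensor_index := (seq nat * seq nat * seq nat * seq nat)%type.

Definition tangle_form (R : realType) N d (X : tensor_index -> R[i]) : R :=
  ((2 : R) ^+ N.-1 - 1)^-1 * \sum_(A : {set 'I_N} | bip_rep A)
    2 * (1 - complex.Re (purity_form N d (sites A) (fun j1 j2 j3 j4 => X (j1, j2, j3, j4)))).

Lemma one_tangleE (R : realType) N d (phi : seq nat -> R[i]) :
  one_tangle N d phi = tangle_form N d (fun q =>
    phi q.1.1.1 * phi q.1.1.2 * conjc (phi q.1.2) * conjc (phi q.2)).
Proof. by congr (_ * _); apply: eq_bigr => A _; rewrite /tau_bip purityE. Qed.

Lemma affine_tangle_form (R : realType) N d : affine (@tangle_form R N d).
Proof.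
apply: affineZ; apply: affine_sum => A; apply: affineZ; apply: affineD; first exact: affine_cst.
rewrite /purity_form; under eq_fun => X.
  rewrite -mulN1r Re_sum; under eq_bigr do rewrite Re_sum; under eq_bigr do under eq_bigr do rewrite Re_sum.
  under eq_bigr do under eq_bigr do under eq_bigr do rewrite Re_sum.
  over.
apply: affineZ; do 4!(apply: affine_sum => ?).
exact: affine_Re.
Qed.

(** * Averaging over the input states, then over the group *)

Section Averages.
Context (R : realType) (N : nat) (d : nat -> nat).
Variable nu : forall i : nat, probability ((d i + d i).-tuple R) R.
Hypothesis Hnu : forall i, (i < N)%N -> uniform_sphere (nu i).

(** [G] extends the integrand to partial lists of states so that integrating out the next state
    turns its value at the longer list into its value at [acc]. Induction on the number of remaining
    sites then peels the integrals from the inside. *)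
Lemma nested_int_affine I (L : (I -> R[i]) -> R) (G : seq (seq R[i]) -> I -> R[i]) F :
  affine L -> (forall psis, size psis = N -> F psis = (L (G psis))%:E) ->
  (forall acc q, (size acc < N)%N ->
     cgood (@sphere R (d (size acc))) (fun x => G (rcons acc (cvec_of_tuple x)) q) /\
     CE (nu (size acc)) (fun x => G (rcons acc (cvec_of_tuple x)) q) = G acc q) ->
  nested_int nu F (iota 0 N) [::] = (L (G [::]))%:E.
Proof.
move=> aL FG step.
suff h m j acc : size acc = j -> (j + m = N)%N ->
    nested_int nu F (iota j m) acc = (L (G acc))%:E by exact: h.
elim: m j acc => [|m IH] j acc sz jm /=; first by rewrite FG // sz -jm addn0.
have jN : (size acc < N)%N by rewrite sz -jm addnS ltnS leq_addr.
rewrite -sz; under eq_integral => x _.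
  rewrite (IH _ (rcons acc (cvec_of_tuple x))) ?size_rcons ?sz //; last by rewrite addSnnS.
  over.
rewrite (@integral_affine _ _ _ _ _ (@sphere R (d (size acc))) _
  (fun q x => G (rcons acc (cvec_of_tuple x)) q)) //.
- by congr (L _)%:E; apply/funext => q; have [] := step acc q jN.
- exact: measurable_sphere.
- by apply: sphere_prob; exact: Hnu.
- by move=> q; have [] := step acc q jN.
Qed.

(* Sites below [size acc] carry a given state; the later ones are already averaged. *)
Definition factor (acc : seq (seq R[i])) i : nat -> nat -> nat -> nat -> R[i] :=
  if (i < size acc)%N then quartic (nth [::] acc i) else sphere_moment (nu i).

Let M := mindices (dims N d).

Definition u_coef n (U : 'M[R[i]]_n) (j k : seq nat) : R[i] :=
  ent U (lin_index (dims N d) j) (lin_index (dims N d) k).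

Definition coef n (U : 'M[R[i]]_n) (q : tensor_index) k1 k2 k3 k4 : R[i] :=
  u_coef U q.1.1.1 k1 * u_coef U q.1.1.2 k2 * conjc (u_coef U q.1.2 k3) * conjc (u_coef U q.2 k4).

(** Interpolates between the tensor of an actual evolved state, for a full list [acc], and its
    complete input average, for the empty list. *)
Definition partial_tensor n (U : 'M[R[i]]_n) (acc : seq (seq R[i])) (q : tensor_index) : R[i] :=
  \sum_(k1 <- M) \sum_(k2 <- M) \sum_(k3 <- M) \sum_(k4 <- M)
    coef U q k1 k2 k3 k4 * \prod_(i < N)
      factor acc i (nth 0%N k1 i) (nth 0%N k2 i) (nth 0%N k3 i) (nth 0%N k4 i).

Lemma evolve_tensor n (U : 'M[R[i]]_n) psis (q : tensor_index) : size psis = N ->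
  evolve N d U psis q.1.1.1 * evolve N d U psis q.1.1.2 *
    conjc (evolve N d U psis q.1.2) * conjc (evolve N d U psis q.2) = partial_tensor U psis q.
Proof.
move=> sz; rewrite /evolve !rmorph_sum prod_quad_sum.
apply: eq_bigr => k1 _; apply: eq_bigr => k2 _; apply: eq_bigr => k3 _; apply: eq_bigr => k4 _.
rewrite !rmorphM /=.
have -> : \prod_(i < N) factor psis i (nth 0%N k1 i) (nth 0%N k2 i) (nth 0%N k3 i) (nth 0%N k4 i)
  = prod_amp N psis k1 * prod_amp N psis k2 * conjc (prod_amp N psis k3) * conjc (prod_amp N psis k4).
  rewrite /prod_amp !rmorph_prod -!big_split /=; apply: eq_bigr => i _.
  by rewrite /factor sz ltn_ord.
by rewrite /coef /u_coef; ring.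
Qed.

Lemma factor_rcons acc psi i : i != size acc -> factor (rcons acc psi) i = factor acc i.
Proof.
move=> ne; rewrite /factor size_rcons ltnS leq_eqVlt (negbTE ne) /= nth_rcons.
by case: ltnP.
Qed.

(** Only the factor of site [size acc] depends on the new state; everything else is a constant
    coefficient, collected in [rest]. *)
Lemma partial_tensor_step n (U : 'M[R[i]]_n) acc q : (size acc < N)%N ->
  cgood (@sphere R (d (size acc))) (fun x => partial_tensor U (rcons acc (cvec_of_tuple x)) q) /\
  CE (nu (size acc)) (fun x => partial_tensor U (rcons acc (cvec_of_tuple x)) q) =
    partial_tensor U acc q.
Proof.
move=> sN; pose j := Ordinal sN.
pose f k1 k2 k3 k4 i := factor acc i (nth 0%N k1 i) (nth 0%N k2 i) (nth 0%N k3 i) (nth 0%N k4 i).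
pose rest k1 k2 k3 k4 := coef U q k1 k2 k3 k4 * \prod_(i < N | i != j) f k1 k2 k3 k4 i.
pose at_j (k : seq nat) := nth 0%N k (size acc).
have e x : partial_tensor U (rcons acc (cvec_of_tuple x)) q =
  \sum_(k1 <- M) \sum_(k2 <- M) \sum_(k3 <- M) \sum_(k4 <- M) rest k1 k2 k3 k4 *
   quartic (@cvec_of_tuple R (d (size acc)) x) (at_j k1) (at_j k2) (at_j k3) (at_j k4).
  apply: eq_bigr => k1 _; apply: eq_bigr => k2 _; apply: eq_bigr => k3 _; apply: eq_bigr => k4 _.
  rewrite /rest -mulrA; congr (_ * _); rewrite (bigD1 j) //= mulrC; congr (_ * _).
    apply: eq_bigr => i ij; rewrite factor_rcons //.
  by rewrite /factor size_rcons ltnSn nth_rcons ltnn eqxx.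
have -> : (fun x => partial_tensor U (rcons acc (cvec_of_tuple x)) q) = _ := funext e.
have g := @cgood_quartic R (d (size acc)).
have c := @cgood_cst R _ _ (@sphere R (d (size acc))).
have mS := @measurable_sphere R (d (size acc)); have S1 := sphere_prob (Hnu sN).
split; first by do 4!(apply: cgood_sum => ?); exact: cgoodM.
rewrite (CE_sum mS S1) => [|k1]; last by do 3!(apply: cgood_sum => ?); exact: cgoodM.
apply: eq_bigr => k1 _; rewrite (CE_sum mS S1) => [|k2]; last by do 2!(apply: cgood_sum => ?); exact: cgoodM.
apply: eq_bigr => k2 _; rewrite (CE_sum mS S1) => [|k3]; last by do 1!(apply: cgood_sum => ?); exact: cgoodM.
apply: eq_bigr => k3 _; rewrite (CE_lin mS S1) //; apply: eq_bigr => k4 _.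
rewrite /rest -mulrA; congr (_ * _); rewrite [RHS](bigD1 j) //= mulrC; congr (_ * _).
by rewrite /factor ltnn.
Qed.

Lemma ent_powerE n (U : 'M[R[i]]_n) :
  ent_power N nu U = (tangle_form N d (partial_tensor U [::]))%:E.
Proof.
apply: (@nested_int_affine _ (@tangle_form R N d) (partial_tensor U)) => [|psis sz|acc q sN].
- exact: affine_tangle_form.
- rewrite one_tangleE; congr (tangle_form N d _)%:E.
  by apply/funext => q; exact: evolve_tensor.
- exact: partial_tensor_step.
Qed.

Section Outer.
Context (dd : measure_display) (T : measurableType dd) (mu : probability T R) (W : set T).
Hypotheses (mW : measurable W) (PW : mu W = 1%E).
Variable Z : T -> 'M[R[i]]_(Dim N d).
Hypothesis gZ : forall i k, cgood W (fun t => Z t i k).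

Lemma cgood_ent a b : cgood W (fun t => ent (Z t) a b).
Proof.
rewrite /ent; case: insubP => [i _ _|_]; last exact: cgood_cst.
case: insubP => [k _ _|_]; [exact: gZ|exact: cgood_cst].
Qed.

Lemma cgood_coef q k1 k2 k3 k4 : cgood W (fun t => coef (Z t) q k1 k2 k3 k4).
Proof. by repeat apply: cgoodM; rewrite //; try apply: cgoodJ; exact: cgood_ent. Qed.

Definition mean_tensor (q : tensor_index) : R[i] := CE mu (fun t => partial_tensor (Z t) [::] q).

Lemma integral_ent_power :
  (\int[mu]_t ent_power N nu (Z t) = (tangle_form N d mean_tensor)%:E)%E.
Proof.
under eq_integral do rewrite ent_powerE.
rewrite (@integral_affine _ _ _ _ mu W (@tangle_form R N d) (fun q t => partial_tensor (Z t) [::] q)) //.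
  exact: affine_tangle_form.
move=> q; do 4!(apply: cgood_sum => ?).
by apply: cgoodM; [exact: cgood_coef|exact: cgood_cst].
Qed.

(** The fourth-moment tensor of a random product state, in linear indices; it takes the place of
    [Q]. *)
Definition input_moment (k1 k2 k3 k4 : 'I_(Dim N d)) : R[i] :=
  \prod_(i < N) sphere_moment (nu i) (nth 0%N (multi_index (dims N d) k1) i)
    (nth 0%N (multi_index (dims N d) k2) i) (nth 0%N (multi_index (dims N d) k3) i)
    (nth 0%N (multi_index (dims N d) k4) i).

Lemma prod_dims : (\prod_(e <- dims N d) e)%N = Dim N d.
Proof. by rewrite /dims big_map /Dim -(big_mkord xpredT d) /index_iota subn0. Qed.

Lemma ent_ord (U : 'M[R[i]]_(Dim N d)) (i k : 'I_(Dim N d)) : ent U i k = U i k.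
Proof. by rewrite /ent !valK. Qed.

Lemma mean_tensorE (j1 j2 j3 j4 : seq nat) (i1 i2 i3 i4 : 'I_(Dim N d)) :
  lin_index (dims N d) j1 = i1 -> lin_index (dims N d) j2 = i2 ->
  lin_index (dims N d) j3 = i3 -> lin_index (dims N d) j4 = i4 ->
  mean_tensor (j1, j2, j3, j4) = weighted_moment mu Z input_moment i1 i2 i3 i4.
Proof.
move=> e1 e2 e3 e4.
have lk (k : 'I_(Dim N d)) : lin_index (dims N d) (multi_index (dims N d) k) = k.
  by rewrite lin_multi_index // prod_dims.
have g k1 k2 k3 k4 := cgood_moment gZ i1 i2 i3 i4 k1 k2 k3 k4.
have c := @cgood_cst R _ _ W.
rewrite /mean_tensor; under eq_fun => t.
  rewrite /partial_tensor (sum_mindices _ prod_dims); under eq_bigr => k1 _.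
    rewrite (sum_mindices _ prod_dims); under eq_bigr => k2 _.
      rewrite (sum_mindices _ prod_dims); under eq_bigr => k3 _.
        rewrite (sum_mindices _ prod_dims); under eq_bigr => k4 _.
          rewrite /coef /u_coef /= e1 e2 e3 e4 !lk !ent_ord mulrC -/(input_moment k1 k2 k3 k4); over.
        over.
      over.
    over.
  over.
rewrite (CE_sum mW PW) => [|k1]; last by do 3!(apply: cgood_sum => ?); exact: cgoodM.
apply: eq_bigr => k1 _; rewrite (CE_sum mW PW) => [|k2]; last by do 2!(apply: cgood_sum => ?); exact: cgoodM.
apply: eq_bigr => k2 _; rewrite (CE_sum mW PW) => [|k3]; last by do 1!(apply: cgood_sum => ?); exact: cgoodM.
by apply: eq_bigr => k3 _; rewrite (CE_lin mW PW).
Qed.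

End Outer.

Hypothesis Hd : forall i, (i < N)%N -> (2 <= d i)%N.

Lemma sum_prod_dims (f : nat -> nat -> nat -> R[i]) :
  \sum_(k < Dim N d) \sum_(l < Dim N d) \prod_(i < N)
    f i (nth 0%N (multi_index (dims N d) k) i) (nth 0%N (multi_index (dims N d) l) i) =
  \prod_(i < N) \sum_(a < d i) \sum_(b < d i) f i a b.
Proof.
have := sum_mindices_prod2 (dims N d) f.
rewrite (sum_mindices _ prod_dims) => h.
transitivity (\sum_(k < Dim N d) \sum_(l <- mindices (dims N d)) \prod_(i < size (dims N d))
    f i (nth 0%N (multi_index (dims N d) k) i) (nth 0%N l i)).
  by apply: eq_bigr => k _; rewrite (sum_mindices _ prod_dims) size_dims.
rewrite h size_dims; apply: eq_bigr => i _.
by rewrite nth_dims.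
Qed.

Lemma input_moment_contract :
  [/\ \sum_k \sum_l input_moment k l k l = 1, \sum_k \sum_l input_moment k l l k = 1
    & \sum_k \sum_l input_moment k k l l = \prod_(i < N) (2 / ((d i)%:R + 1))].
Proof.
have s (i : 'I_N) := sphere_moment_contract (Hnu (ltn_ord i)) (Hd (ltn_ord i)).
split.
- rewrite (sum_prod_dims (fun i a b => sphere_moment (nu i) a b a b)).
  by apply: big1 => i _; have [] := s i.
- rewrite (sum_prod_dims (fun i a b => sphere_moment (nu i) a b b a)).
  by apply: big1 => i _; have [] := s i.
- rewrite (sum_prod_dims (fun i a b => sphere_moment (nu i) a a b b)).
  by apply: eq_bigr => i _; have [] := s i.
Qed.

End Averages.

(** * Counting bipartitions and the constants *)

Lemma prod_sites N d (A : {set 'I_N}) : (\prod_(i <- sites A) d i = \prod_(i in A) d (val i))%N.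
Proof. by rewrite /sites big_map big_enum. Qed.

Lemma mem_sites N (A : {set 'I_N}) (i : 'I_N) : (val i \in sites A) = (i \in A).
Proof. by rewrite /sites mem_map ?mem_enum //; exact: val_inj. Qed.

Lemma prod_sitesC N d (A : {set 'I_N}) :
  (\prod_(i <- [seq i <- iota 0 N | i \notin sites A]) d i = \prod_(i in ~: A) d (val i))%N.
Proof.
have := big_mkord (op := muln) (idx := 1%N) (fun i => i \notin sites A) d (n := N).
rewrite big_filter /index_iota subn0 => ->.
by apply: eq_bigl => i; rewrite finset.in_setC mem_sites.
Qed.

Lemma uniq_sites N (A : {set 'I_N}) : uniq (sites A).
Proof. by rewrite map_inj_uniq ?enum_uniq //; exact: val_inj. Qed.

Lemma sub_sites N (A : {set 'I_N}) : {subset sites A <= iota 0 N}.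
Proof. by move=> x /mapP[i _ ->]; rewrite mem_iota /= ltn_ord. Qed.

Lemma prod_split N (d : nat -> nat) (A : {set 'I_N}) :
  ((\prod_(i in A) d (val i)) * (\prod_(i in ~: A) d (val i)) = Dim N d)%N.
Proof.
rewrite /Dim [RHS](bigID (fun i => i \in A)) /=; congr (_ * _)%N.
by apply: eq_bigl => i; rewrite finset.in_setC.
Qed.

Lemma bip_repE N (A : {set 'I_N.+1}) : bip_rep A = (ord0 \in A) && (A != [set: 'I_N.+1]%SET).
Proof.
congr (_ && _); apply/existsP/idP => [[i /andP[iA /eqP i0]]|h]; last by exists ord0; rewrite h.
by rewrite (_ : ord0 = i) //; apply: val_inj.
Qed.

(** There are N + 1 sites here. Complementation matches the sets containing site 0 with the subsets
    of the N other sites; the full set, which leaves the other part empty, is removed. *)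
Lemma card_bip_rep N : #|[set A : {set 'I_N.+1} | bip_rep A]%SET| = (2 ^ N - 1)%N.
Proof.
pose S := [set A : {set 'I_N.+1} | ord0 \in A]%SET.
have -> : [set A : {set 'I_N.+1} | bip_rep A]%SET = (S :\ [set: 'I_N.+1])%SET.
  by apply/setP => A; rewrite !inE bip_repE andbC.
have := cardsD1 [set: 'I_N.+1]%SET S; rewrite !inE /= => h.
have -> : (2 ^ N)%N = #|S|.
  have -> : S = [set ~: B | B in powerset (~: [set ord0])]%SET.
    apply/setP => A; rewrite inE; apply/idP/imsetP => [hA|[B]].
      by exists (~: A)%SET; rewrite ?finset.setCK // powersetE finset.setCS finset.sub1set.
    by rewrite powersetE -finset.setCS finset.setCK finset.sub1set => hB ->.
  rewrite card_imset; last exact: (can_inj (@finset.setCK _)).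
  by rewrite card_powerset finset.cardsC1 card_ord.
by rewrite h addKn.
Qed.

Lemma sum_bip_rep (R : realType) N : (0 < N)%N ->
  \sum_(A : {set 'I_N} | bip_rep A) (1 : R) = 2 ^+ N.-1 - 1.
Proof.
case: N => // N _; rewrite -natrX -[1 in RHS]/(1%:R) -natrB ?expn_gt0 // -card_bip_rep.
by rewrite -sumr_const; apply: eq_bigl => A; rewrite inE.
Qed.

Lemma constBE (R : realType) N d : (constB N d)%:R = \prod_(i < N) ((d i)%:R + 1) :> R.
Proof.
rewrite bigA_distr /constB natr_sum; apply: eq_bigr => A _.
rewrite natr_prod big_mkcond; apply: eq_bigr => i _.
by case: (i \in A).
Qed.

(** * Solving for the two averages *)

Section Main.
Context (R : realType) (N : nat) (d : nat -> nat).
Hypotheses (HN : (2 <= N)%N) (Hd : forall i, (i < N)%N -> (2 <= d i)%N).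
Variable nu : forall i : nat, probability ((d i + d i).-tuple R) R.
Hypothesis Hnu : forall i, (i < N)%N -> uniform_sphere (nu i).

Lemma Dim_gt1 : (1 < Dim N d)%N.
Proof.
case: N HN Hd => // n _ h; rewrite /Dim big_ord_recl.
have : (0 < \prod_(i < n) d (lift ord0 i))%N.
  by apply: prodn_gt0 => i; apply: leq_trans (h _ _) => //; rewrite ltn_ord.
by move=> h0; apply: leq_trans (h 0%N isT) _; rewrite leq_pmulr.
Qed.

Lemma K_neq0 : (2 : R) ^+ N.-1 - 1 != 0.
Proof.
rewrite subr_eq0 -natrX (eqr_nat _ _ 1); case: N HN => [|[|n]] // _.
by rewrite /= -[1%N](expn0 2) eqn_exp2l.
Qed.

(** As the first two pairings share the coefficient [x], each bipartition contributes through d_A +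
    d_B' only, and these sums add up to [constC]. *)
Lemma tangle_form_pairings (X : tensor_index -> R[i]) (x y : R[i]) :
  (forall j1 j2 j3 j4, j1 \in mindices (dims N d) -> j2 \in mindices (dims N d) ->
     j3 \in mindices (dims N d) -> j4 \in mindices (dims N d) ->
    X (j1, j2, j3, j4) = x * ((j1 == j3) && (j2 == j4))%:R
      + x * ((j1 == j4) && (j2 == j3))%:R + y * ((j1 == j2) && (j3 == j4))%:R) ->
  tangle_form N d X =
   2 * (1 - (Dim N d)%:R * (complex.Re x * (constC N d)%:R / ((2 : R) ^+ N.-1 - 1) + complex.Re y)).
Proof.
move=> XE; set K := 2 ^+ N.-1 - 1; have K0 : K != 0 := K_neq0.
have term (A : {set 'I_N}) : 2 * (1 - complex.Re (purity_form N d (sites A) (fun j1 j2 j3 j4 => X (j1, j2, j3, j4))))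
  = 2 * (1 - (Dim N d)%:R * complex.Re y) * 1 - 2 * (Dim N d)%:R * complex.Re x *
     ((\prod_(i in A) d (val i) + \prod_(i in ~: A) d (val i))%N)%:R.
  rewrite (purity_form_pairings (uniq_sites A) (@sub_sites _ A) XE) prod_sites prod_sitesC.
  rewrite -(prod_split d A) natrD !natrM.
  move: (\prod_(i in A) d (val i))%N (\prod_(i in ~: A) d (val i))%N => a b.
  rewrite -!natrM [x * _]mulrC [_ * (a * a * b)%:R]mulrC [_ * (a * b)%:R]mulrC !ReD !Re_natM !natrM.
  by ring.
rewrite /tangle_form -/K (eq_bigr _ (fun A _ => term A)) big_split /= -mulr_sumr sumrN -mulr_sumr.
rewrite sum_bip_rep ?(ltnW HN) // -/K -natr_sum -/(constC N d).
by field.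
Qed.

(** Both input normalisations equal 1, so subtracting the first two equations gives (x - x') D (D -
    1) = 0 and two unknowns remain. *)
Lemma mean_tensor_pairings (dd : measure_display) (T : measurableType dd) (mu : probability T R)
    (W : set T) (Z : T -> 'M[R[i]]_(Dim N d)) :
  measurable W -> mu W = 1%E -> (forall i k, cgood W (fun t => Z t i k)) -> isometric W Z ->
  (forall V, orthogonal_mx V -> left_invariant mu Z (map_mx (real_complex R) V)) ->
  exists x y : R[i],
  [/\ (\int[mu]_t ent_power N nu (Z t) = (2 * (1 - (Dim N d)%:R *
         (complex.Re x * (constC N d)%:R / ((2 : R) ^+ N.-1 - 1) + complex.Re y)))%:E)%E,
      x * (Dim N d * Dim N d)%:R + x * (Dim N d)%:R + y * (Dim N d)%:R = 1,
      (forall t i k, conjc (Z t i k) = Z t i k) ->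
        x * (Dim N d)%:R + x * (Dim N d)%:R + y * (Dim N d * Dim N d)%:R =
          \prod_(i < N) (2 / ((d i)%:R + 1))
    & (forall o, left_invariant mu Z (phase_mx R o)) -> y = 0].
Proof.
move=> mW PW gZ isoZ orthZ.
have D1 := Dim_gt1.
have [x [x' [y [E e1 e2 e3 y0]]]] :=
  weighted_moment_structure mW PW gZ orthZ D1 (input_moment nu) isoZ.
have [c1 c2 c3] := input_moment_contract Hnu Hd.
rewrite c1 in e1; rewrite c2 in e2; rewrite c3 in e3.
have xx' : x = x'.
  have Dn0 : (Dim N d)%:R != 0 :> R[i] by rewrite pnatr_eq0 -lt0n ltnW.
  have Dm0 : (Dim N d)%:R - 1 != 0 :> R[i] by rewrite subr_eq0 (eqr_nat _ _ 1) gtn_eqF.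
  have : (x - x') * ((Dim N d)%:R * ((Dim N d)%:R - 1)) = 0.
    apply: etrans (_ : _ = (x * ((Dim N d)%:R * (Dim N d)%:R) + x' * (Dim N d)%:R + y * (Dim N d)%:R)
      - (x * (Dim N d)%:R + x' * ((Dim N d)%:R * (Dim N d)%:R) + y * (Dim N d)%:R)) _; first by ring.
    by rewrite e1 e2 subrr.
  by move/eqP; rewrite mulf_eq0 mulf_eq0 (negbTE Dn0) (negbTE Dm0) !orbF subr_eq0 => /eqP.
subst x'; exists x, y; split => //.
- rewrite (integral_ent_power Hnu mW PW gZ); congr _%:E.
  apply: tangle_form_pairings => j1 j2 j3 j4 h1 h2 h3 h4.
  have lt j (h : j \in mindices (dims N d)) : (lin_index (dims N d) j < Dim N d)%N.
    by rewrite -prod_dims lin_index_lt.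
  rewrite (@mean_tensorE _ _ _ nu _ _ mu W mW PW Z gZ j1 j2 j3 j4
    (Ordinal (lt _ h1)) (Ordinal (lt _ h2)) (Ordinal (lt _ h3)) (Ordinal (lt _ h4))) // E.
  (* The deltas compare positions; injectivity of [lin_index] on valid multi-indices turns them into
     deltas of multi-indices. *)
  by rewrite -!val_eqE /= !(inj_in_eq (@lin_index_inj (dims N d))).
- by rewrite natrM.
- by rewrite natrM.
Qed.

End Main.

Theorem mainTheorem10 (R : realType) (N : nat) (d : nat -> nat)
  (HN : (2 <= N)%N) (Hd : forall i, (i < N)%N -> (2 <= d i)%N)
  (nu : forall i : nat, probability ((d i + d i).-tuple R) R)
  (Hnu : forall i, (i < N)%N -> uniform_sphere (nu i))
  (muO : probability ((Dim N d * Dim N d).-tuple R) R)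
  (HmuO : Haar_orthogonal muO)
  (muU : probability ((Dim N d * Dim N d + Dim N d * Dim N d).-tuple R) R)
  (HmuU : Haar_unitary muU) :
  let D : R := (Dim N d)%:R in
  let B : R := (constB N d)%:R in
  let C : R := (constC N d)%:R in
  let P : R := \prod_(i < N) ((d i)%:R + 1)^-1 in
  let K : R := (2 : R) ^+ N.-1 - 1 in
  (\int[muO]_t ent_power N nu (map_mx (real_complex R) (rmx_of_tuple t)))%E
    = (2 * (1 - P * ((2 ^+ N * (D + 1) - 2 * B + (B * D - 2 ^+ N) / K * C)
                      / ((D - 1) * (D + 2)))))%:E
  /\
  (\int[muU]_t ent_power N nu (cmx_of_tuple t))%E
    = (2 * (1 - P * (B * C / (K * (D + 1)))))%:E.
Proof.
move=> D B C P K.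
have K0 : K != 0 := @K_neq0 R N HN.
have D1 : 1 < D by rewrite /D (ltr_nat _ 1) (Dim_gt1 HN Hd).
have D0 : 0 < D := lt_trans ltr01 D1.
have PB : P * B = 1.
  rewrite /P /B constBE -big_split /=; apply: big1 => i _.
  by rewrite mulVf // natr1 pnatr_eq0.
split.
- have mW : measurable [set t : (Dim N d * Dim N d).-tuple R | orthogonal_mx (rmx_of_tuple t)].
    by rewrite orthogonal_set; apply: measurable_unitary => i j; exact: cgood0_rmx_of_tuple.
  have [x [y [-> e1 e2 _]]] := @mean_tensor_pairings R N d HN Hd nu Hnu _ _ muO _
     (fun t => map_mx (real_complex R) (rmx_of_tuple t)) mW HmuO.1
     ltac:(by rewrite orthogonal_set => i k; apply: cgood_unitary => a b; exact: cgood0_rmx_of_tuple)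
     ltac:(by rewrite orthogonal_set; exact: unitary_isometric)
     (fun V oV => haar_orthogonal_invariant HmuO oV).
  have {}e2 := e2 ltac:(by move=> t i k; rewrite !mxE conjc_real).
  congr _%:E; rewrite -/C -/K -/D.
  have PE : complex.Re (\prod_(i < N) (2 / ((d i)%:R + 1))) = 2 ^+ N * P.
    rewrite (_ : \prod_(i < N) _ = real_complex R (2 ^+ N * P)) //.
    rewrite /P rmorphM rmorphXn rmorph_nat rmorph_prod.
    rewrite big_split /= prodr_const card_ord; congr (_ * _); apply: eq_bigr => i _.
    by rewrite fmorphV rmorphD rmorph_nat rmorph1.
  move: e2 => /(congr1 (@complex.Re R)); rewrite PE.
  move: e1 => /(congr1 (@complex.Re R)) /=.
  rewrite !(mulrC x) !(mulrC y) !ReD !Re_natM !natrM -/D.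
  move: (complex.Re x) (complex.Re y) => {PE}x {}y e1 e2.
  have M0 : (D - 1) * (D + 2) != 0.
    by apply: lt0r_neq0; rewrite mulr_gt0 ?subr_gt0 ?addr_gt0.
  (* D times the first equation minus the second eliminates y; the determinant is D^2 + D - 2 = (D -
     1) (D + 2). *)
  have hx : D * x = (D - 2 ^+ N * P) / ((D - 1) * (D + 2)).
    apply: (@mulIf _ _ M0); rewrite divfK // -[D in RHS]mulr1 -e2 -[X in D * X - _]e1; ring.
  (* D + 1 times the second equation minus twice the first eliminates x. *)
  have hy : D * y = (2 ^+ N * P * (D + 1) - 2) / ((D - 1) * (D + 2)).
    apply: (@mulIf _ _ M0); rewrite divfK // -e2 -[X in _ = _ - X]mulr1 -[X in _ = _ - _ * X]e1; ring.
  (* Distributing P leaves [B] only in the product P B, which is 1. *)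
  have -> : P * ((2 ^+ N * (D + 1) - 2 * B + (B * D - 2 ^+ N) / K * C) / ((D - 1) * (D + 2)))
    = (2 ^+ N * P * (D + 1) - 2 * (P * B) + (P * B * D - 2 ^+ N * P) / K * C) / ((D - 1) * (D + 2)).
    by ring.
  have -> : D * (x * C / K + y) = D * x * C / K + D * y by ring.
  by rewrite PB hx hy; ring.
- have mW : measurable [set t : (Dim N d * Dim N d + Dim N d * Dim N d).-tuple R | unitary_mx (cmx_of_tuple t)].
    by apply: measurable_unitary => i j; exact: cgood0_cmx_of_tuple.
  have [x [y [-> e1 _ y0]]] := @mean_tensor_pairings R N d HN Hd nu Hnu _ _ muU _
     (@cmx_of_tuple R (Dim N d)) mW HmuU.1
     (fun i k => cgood_unitary i k (@cgood0_cmx_of_tuple R (Dim N d)))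
     (@unitary_isometric R _ _ _ _)
     (fun V oV => haar_unitary_invariant HmuU (orthogonal_unitary oV)).
  have {}y0 := y0 (fun o => haar_unitary_invariant HmuU (phase_mx_unitary R o)).
  congr _%:E; rewrite -/C -/K -/D; subst y.
  move: e1 => /(congr1 (@complex.Re R)) /=.
  rewrite !(mulrC x) mul0r addr0 !ReD !Re_natM !natrM -/D.
  move: (complex.Re x) => {}x e1.
  have D10 : D + 1 != 0 by apply: lt0r_neq0; rewrite addr_gt0.
  (* With y = 0 the normalisation reads D x (D + 1) = 1. *)
  have hx : D * x = (D + 1)^-1.
    by apply: (@mulIf _ _ D10); rewrite mulVf // -[RHS]e1; ring.
  have -> : P * (B * C / (K * (D + 1))) = P * B * C / (K * (D + 1)) by ring.
  have -> : D * (x * C / K + 0) = D * x * C / K by ring.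
  by rewrite PB hx invfM; ring.
Qed.
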